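(* The operad $\mathcal{P}reLie\bullet\mathcal{N}$ is not Koszul.
   Context: The ground field $k$ has characteristic $0$. For a finite dimensional right $\mathbb{S}_2$-module $V$ (concentrated in arity $2$), $\mathcal{F}(V)$ is the free operad; $\mathcal{F}(V)(3)$ is the direct sum of three copies of $V\otimes V$ spanned by $\mu\circ_{\mathrm I}\nu=\mu(\nu(x,y),z)$, $\mu\circ_{\mathrm{II}}\nu=\mu(\nu(y,z),x)$, $\mu\circ_{\mathrm{III}}\nu=\mu(\nu(z,x),y)$. A binary quadratic operad is $\mathcal{F}(V)/(R)$ with $R\subset\mathcal{F}(V)(3)$ a sub-$\mathbb{S}_3$-module. Black product of $\mathcal{P}=\mathcal{F}(V)/(R)$ and $\mathcal{Q}=\mathcal{F}(W)/(S)$: $\mathcal{P}\bullet\mathcal{Q}=\mathcal{F}(V\otimes W\otimes k\cdot\mathrm{sgn}_{\mathbb{S}_2})/(\Psi(R\otimes S))$ with $\Psi((\mu\circ_\alpha\nu)\otimes(\mu'\circ_\beta\nu'))=\delta_{\alpha\beta}(\mu\otimes\mu'\otimes1)\circ_\alpha(\nu\otimes\nu'\otimes1)$. $\mathcal{P}reLie$ is the operad of right preLie algebras: one binary operation without symmetry with $(xy)z-x(yz)=(xz)y-x(zy)$. $\mathcal{N}$ is the nilpotent operad: generated by one skew-symmetric binary operation such that every composition of it with itself vanishes (i.e. $R=\mathcal{F}(V)(3)$ with $V=\mathrm{sgn}_{\mathbb{S}_2}$). A quadratic operad $\mathcal{P}$ is Koszul if the homology of its bar construction $\mathcal{B}(\mathcal{P})=\mathcal{F}^c(s\overline{\mathcal{P}})$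 (the cofree connected cooperad on the suspension of the augmentation ideal, with differential induced by partial compositions) is concentrated in top dimension: in weight $\omega$ (total number of generating operations), homology is concentrated in degree $\omega$ (number of vertices). *)

(* Defs.v *)
From HB Require Import structures.
From mathcomp Require Import all_boot all_order all_algebra.

Set Implicit Arguments.
Unset Strict Implicit.
Unset Printing Implicit Defensive.

Import GRing.Theory.
Local Open Scope ring_scope.

(* A finite dimensional right S_2-module V, with basis (e_i)_(i : s2_basis);
   the transposition acts by e_i . (1 2) = \sum_j s2_swap i j e_j.  Seen as a
   binary operation, (mu . (1 2))(x, y) = mu(y, x). *)
Record s2_module (k : fieldType) := S2Module {
  s2_basis : finType;
  s2_swap : s2_basis -> s2_basis -> k;
  s2_swapK : forall i l,
    \sum_j s2_swap i j * s2_swap j l = (i == l)%:R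
}.

Section Arity3.
Variable k : fieldType.

(* F(V)(3), three copies of V (x) V.  The basis vector (a, i, j) is
   e_i(e_j(x_a, x_(a+1)), x_(a+2)), indices modulo 3: a = 0, 1, 2 are the
   compositions o_I, o_II and o_III of e_i with e_j. *)
Definition free3 (I : finType) := {ffun 'I_3 * I * I -> k^o}.

Definition e3 (I : finType) (a : 'I_3) (i j : I) : free3 I :=
  [ffun w => (w == (a, i, j))%:R].

Variable V : s2_module k.
Local Notation I := (s2_basis V).

(* Renaming x_a to x_(a+1), and exchanging x_0 and x_1; these two operations
   generate the action of S_3. *)
Definition rot3 (f : free3 I) : free3 I :=
  [ffun w => f (w.1.1 - 1, w.1.2, w.2)].
Definition flip3 (f : free3 I) : free3 I :=
  [ffun w => \sum_j f (- w.1.1, w.1.2, j) * s2_swap j w.2].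

Definition s3_stable (U : {vspace free3 I}) :=
  forall f, f \in U -> rot3 f \in U /\ flip3 f \in U.

Lemma rot3_is_linear : linear rot3.
Proof. by move=> c f g; apply/ffunP=> w; rewrite !ffunE. Qed.
HB.instance Definition _ :=
  GRing.isLinear.Build k (free3 I) (free3 I) _ rot3 rot3_is_linear.

Lemma flip3_is_linear : linear flip3.
Proof.
move=> c f g; apply/ffunP=> w; rewrite !ffunE scaler_sumr -big_split /=.
by apply: eq_bigr => j _; rewrite !ffunE mulrDl /GRing.scale /= mulrA.
Qed.
HB.instance Definition _ :=
  GRing.isLinear.Build k (free3 I) (free3 I) _ flip3 flip3_is_linear.

Lemma s3_stable_span (X : seq (free3 I)) :
    (forall f, f \in X -> rot3 f \in <<X>>%VS /\ flip3 f \in <<X>>%VS) ->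
  s3_stable <<X>>.
Proof.
move=> stX f /(@coord_span _ _ _ (in_tuple X))->; rewrite !linear_sum /=.
by split; apply: rpred_sum => i _; rewrite linearZ /= rpredZ //;
   have [] := stX X`_i (mem_nth 0 (ltn_ord i)).
Qed.

End Arity3.

(* The data (V, R) of a binary quadratic operad F(V)/(R). *)
Record quadratic_data (k : fieldType) := QuadraticData {
  qd_gen : s2_module k;
  qd_rel : {vspace free3 k (s2_basis qd_gen)};
  qd_relP : s3_stable qd_rel
}.

Section BlackProduct.
Variable k : fieldType.

Section Generators.
Variables V W : s2_module k.

(* V (x) W (x) sgn. *)
Definition black_swap (p q : s2_basis V * s2_basis W) : k :=
  - (s2_swap p.1 q.1 * s2_swap p.2 q.2).

Lemma black_swapK p q :
  \sum_r black_swap p r * black_swap r q = (p == q)%:R.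
Proof.
case: p q => [i i'] [l l']; rewrite xpair_eqE -mulnb natrM -!s2_swapK.
rewrite big_distrlr pair_big /=; apply: eq_bigr => r _.
by rewrite /black_swap mulrNN mulrACA.
Qed.

Definition black_gen : s2_module k := S2Module black_swapK.

Definition Psi (r : free3 k (s2_basis V)) (s : free3 k (s2_basis W)) :
    free3 k (s2_basis black_gen) :=
  [ffun w => r (w.1.1, w.1.2.1, w.2.1) * s (w.1.1, w.1.2.2, w.2.2)].

Lemma Psi_rot r s : rot3 (Psi r s) = Psi (rot3 r) (rot3 s).
Proof. by apply/ffunP=> w; rewrite !ffunE. Qed.

Lemma Psi_flip r s : flip3 (Psi r s) = - Psi (flip3 r) (flip3 s).
Proof.
apply/ffunP=> w; rewrite !ffunE /= big_distrlr pair_big /= -sumrN.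
by apply: eq_bigr => j _; rewrite !ffunE /= /black_swap mulrN mulrACA.
Qed.

End Generators.

Section Relations.
Variables P Q : quadratic_data k.
Local Notation R := (qd_rel P).
Local Notation S := (qd_rel Q).

Definition black_rel_gens :=
  [seq Psi r s | r <- vbasis R, s <- vbasis S].

(* Psi(R (x) S). *)
Definition black_rel : {vspace free3 k (s2_basis (black_gen (qd_gen P) (qd_gen Q)))} :=
  <<black_rel_gens>>%VS.

Lemma mem_black_rel r s : r \in R -> s \in S -> Psi r s \in black_rel.
Proof.
move=> Rr Ss; have -> : Psi r s = \sum_i \sum_j
    (coord (vbasis R) i r * coord (vbasis S) j s) *:
       Psi (vbasis R)`_i (vbasis S)`_j.
  rewrite {1}(coord_vbasis Rr) {1}(coord_vbasis Ss).
  apply/ffunP=> w; rewrite !ffunE !sum_ffunE big_distrlr /=.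
  apply: eq_bigr => i _; rewrite sum_ffunE; apply: eq_bigr => j _.
  by rewrite !ffunE /GRing.scale /= mulrACA.
do 2![apply: rpred_sum => ? _]; rewrite rpredZ // memv_span //.
by apply: allpairs_f; rewrite mem_nth ?size_tuple.
Qed.

Lemma black_relP : s3_stable black_rel.
Proof.
apply: s3_stable_span => _ /allpairsP[[r s] /= [Rr Ss ->]].
have [[rR fR] [rS fS]] := (qd_relP (vbasis_mem Rr), qd_relP (vbasis_mem Ss)).
by rewrite Psi_rot Psi_flip rpredN; split; apply: mem_black_rel.
Qed.

Definition black_product : quadratic_data k := QuadraticData black_relP.

End Relations.
End BlackProduct.

Section Examples.
Variable k : fieldType.

(* The regular representation: false is the product x y and true its opposite
   y x. *)
Definition reg_swap (b c : bool) : k := (c == ~~ b)%:R.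

Lemma reg_swapK b c : \sum_d reg_swap b d * reg_swap d c = (b == c)%:R.
Proof.
by rewrite big_bool; case: b c => [] []; rewrite /reg_swap /= !(mulr0, mul0r, mulr1, addr0, add0r).
Qed.

Definition reg_gen : s2_module k := S2Module reg_swapK.

(* (x y) z - x (y z) - (x z) y + x (z y) for (x, y, z) = (x_a, x_(a+1), x_(a+2)). *)
Definition prelie_relator (a : 'I_3) : free3 k (s2_basis reg_gen) :=
  e3 k a false false - e3 k (a + 1) true false
  - e3 k (a + 2) false true + e3 k (a + 1) true true.

Definition prelie_rel := <<[seq prelie_relator a | a : 'I_3]>>%VS.

Lemma e3_rot a i j : rot3 (e3 k a i j : free3 k (s2_basis reg_gen)) = e3 k (a + 1) i j.
Proof.
by apply/ffunP=> -[[b i'] j']; rewrite !ffunE /= !xpair_eqE subr_eq.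
Qed.

Lemma e3_flip a i j : flip3 (e3 k a i j : free3 k (s2_basis reg_gen)) = e3 k (- a) i (~~ j).
Proof.
apply/ffunP=> -[[b i'] j']; rewrite !ffunE /= (bigD1 j) //= big1 => [|l jl].
  rewrite addr0 !ffunE !xpair_eqE eqxx andbT eqr_oppLR /reg_swap -natrM mulnb.
  by [].
by rewrite !ffunE !xpair_eqE (negPf jl) andbF mul0r.
Qed.

Lemma prelie_relP : s3_stable prelie_rel.
Proof.
apply: s3_stable_span => _ /mapP[a _ ->].
have rotE : rot3 (prelie_relator a) = prelie_relator (a + 1).
  rewrite /prelie_relator !(linearB, linearD, linearN) /= !e3_rot.
  by rewrite [a + 2 + 1]addrAC.
have flipE : flip3 (prelie_relator a) = - prelie_relator (1 - a).
  clear rotE; rewrite /prelie_relator !(linearB, linearD, linearN) /= !e3_flip /=.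
  have [-> ->] : - (a + 1) = 1 - a + 1 /\ - (a + 2) = 1 - a :> 'I_3.
    by move: a => [[|[|[|]]] ?] //; split; apply: val_inj.
  have -> : 1 - a + 2 = - a :> 'I_3.
    by move: a => [[|[|[|]]] ?] //; apply: val_inj.
  by rewrite !opprK -[LHS]addrA [LHS]addrC addrA.
by rewrite rotE flipE rpredN; split; apply/memv_span/map_f/mem_enum.
Qed.

Definition prelie_operad : quadratic_data k := QuadraticData prelie_relP.

Definition sgn_swap (_ _ : unit) : k := -1.

Lemma sgn_swapK i l : \sum_j sgn_swap i j * sgn_swap j l = (i == l)%:R.
Proof. by case: i l => [] []; rewrite (bigD1 tt) //= big1 => [|[]] //; rewrite addr0 mulrNN mulr1. Qed.

Definition sgn_gen : s2_module k := S2Module sgn_swapK.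

Lemma nil_relP : s3_stable (fullv : {vspace free3 k (s2_basis sgn_gen)}).
Proof. by move=> f _; rewrite !memvf. Qed.

Definition nil_operad : quadratic_data k := QuadraticData nil_relP.

End Examples.

(* Planar binary trees: tree monomials in the generating operations I, with
   leaves labelled by L. *)
Inductive tree (I L : Type) :=
  | Leaf of L
  | Node of I & tree I L & tree I L.
Arguments Leaf {I L}.

Section TreeChoice.
Variables I L : countType.

Fixpoint tree_encode (t : tree I L) : GenTree.tree (I + L) :=
  match t with
  | Leaf x => GenTree.Leaf (inr x)
  | Node i l r =>
      GenTree.Node 0 [:: GenTree.Leaf (inl i); tree_encode l; tree_encode r]
  end.

Fixpoint tree_decode (g : GenTree.tree (I + L)) : option (tree I L) :=
  match g with
  | GenTree.Leaf (inr x) => Some (Leaf x)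
  | GenTree.Node 0 [:: GenTree.Leaf (inl i); l; r] =>
      match tree_decode l, tree_decode r with
      | Some l', Some r' => Some (Node i l' r')
      | _, _ => None
      end
  | _ => None
  end.

Lemma tree_encodeK : pcancel tree_encode tree_decode.
Proof. by elim=> [x|i l IHl r IHr] //=; rewrite IHl IHr. Qed.

HB.instance Definition _ := Countable.copy (tree I L) (pcan_type tree_encodeK).

End TreeChoice.

Fixpoint leaves (I L : Type) (t : tree I L) : seq L :=
  match t with
  | Leaf x => [:: x]
  | Node _ l r => leaves l ++ leaves r
  end.

Fixpoint tree_bind (I L M : Type) (f : L -> tree I M) (t : tree I L) : tree I M :=
  match t with
  | Leaf x => f x
  | Node i l r => Node i (tree_bind f l) (tree_bind f r)
  end.

Definition graft (I : Type) (L : eqType) (x : L) (t u : tree I L) :=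
  tree_bind (fun y => if y == x then u else Leaf y) t.

(* A context is a tree in which the label None occurs once, as a hole. *)
Definition plug (I L : Type) (c : tree I (option L)) (t : tree I L) :=
  tree_bind (fun y => if y is Some z then Leaf z else t) c.

Section FiniteTrees.
Variables I L : finType.

Fixpoint trees_upto (h : nat) : seq (tree I L) :=
  [seq Leaf x | x <- enum L] ++
  (if h is h'.+1 then
     flatten [seq [seq Node i l r | l <- trees_upto h', r <- trees_upto h'] | i <- enum I]
   else [::]).

(* The trees with pairwise distinct leaves. *)
Definition trees : seq (tree I L) :=
  [seq t <- trees_upto #|L| | uniq (leaves t)].

Lemma mem_trees_upto h t : (size (leaves t) <= h.+1)%N -> t \in trees_upto h.
Proof.
have leaves_gt0 u : (0 < size (leaves (u : tree I L)))%N.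
  by elim: u => //= i l IHl r _; rewrite size_cat addn_gt0 IHl.
elim: h t => [|h IHh] [x|i l r] /=; rewrite ?size_cat mem_cat => szt;
  try by rewrite map_f ?mem_enum.
  have := leq_trans (leq_add (leaves_gt0 l) (leaves_gt0 r)) szt.
  by rewrite ltnn.
apply/orP; right; apply/flattenP; eexists; first exact/map_f/(mem_enum I i).
apply: allpairs_f; apply: IHh; rewrite -ltnS.
  by apply: leq_trans szt; rewrite -addn1 leq_add2l leaves_gt0.
by apply: leq_trans szt; rewrite -add1n leq_add2r leaves_gt0.
Qed.

Lemma mem_trees t : (t \in trees) = uniq (leaves t).
Proof.
rewrite mem_filter andb_idr // => Ut; apply: mem_trees_upto.
by rewrite ltnW // ltnS -(card_uniqP Ut) max_card.
Qed.

End FiniteTrees.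

Notation utree I L := (seq_sub (trees I L)).

Section QuadraticOperad.
Variables (k : fieldType) (P : quadratic_data k).
Local Notation V := (qd_gen P).
Local Notation I := (s2_basis V).

(* The component of an operad on a finite set X of inputs; taking L = 'I_n and
   X = setT gives the usual component of arity n. *)
Section Component.
Variable L : finType.

Definition monomials (X : {set L}) :=
  seq_sub [seq t <- trees I L | [set x in leaves t] == X].

Definition monomial_space (X : {set L}) := {ffun monomials X -> k^o}.

(* Zero unless t has leaves X. *)
Definition mono (X : {set L}) (t : tree I L) : monomial_space X :=
  [ffun u => (val u == t)%:R].

(* F(V)(X) is the quotient of monomial_space X by the equivariance relations
   e_i(l, r) = (e_i . (1 2))(r, l), at any vertex of a tree. *)
Definition equivariance_rel (X : {set L}) : {vspace monomial_space X} :=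
  (\sum_(c : utree I (option L) | None \in leaves (val c))
     \sum_i \sum_(l : utree I L) \sum_(r : utree I L)
       <[mono X (plug (val c) (Node i (val l) (val r)))
         - \sum_j s2_swap i j *: mono X (plug (val c) (Node j (val r) (val l)))]>)%VS.

(* The tree monomial of the basis vector (a, i, j) of F(V)(3), with t_0, t_1,
   t_2 substituted for x_0, x_1, x_2. *)
Definition tree3 (a : 'I_3) (i j : I) (t : 'I_3 -> tree I L) :=
  Node i (Node j (t a) (t (a + 1))) (t (a + 2)).

Definition plug3 (X : {set L}) (c : tree I (option L)) (f : free3 k I)
    (t0 t1 t2 : tree I L) : monomial_space X :=
  \sum_w f w *: mono X (plug c (tree3 w.1.1 w.1.2 w.2 (tnth [tuple t0; t1; t2]))).

(* The operadic ideal (R). *)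
Definition ideal_rel (X : {set L}) : {vspace monomial_space X} :=
  (\sum_(c : utree I (option L) | None \in leaves (val c))
     \sum_(t0 : utree I L) \sum_(t1 : utree I L) \sum_(t2 : utree I L)
       <<[seq plug3 X (val c) f (val t0) (val t1) (val t2)
         | f <- vbasis (qd_rel P)]>>)%VS.

Definition operad_rel X : {vspace monomial_space X} :=
  (equivariance_rel X + ideal_rel X)%VS.

(* The quotient of monomial_space X by operad_rel X, represented by a
   complement; operad_proj is the quotient map. *)
Definition operad_space X : {vspace monomial_space X} := (operad_rel X)^C%VS.

Definition operad_proj X : 'End(monomial_space X) :=
  daddv_pi (operad_space X) (operad_rel X).

(* p o_x q, for p in (F(V)/(R))(X), x \in X and q in (F(V)/(R))(Y), where Y is
   disjoint from X :\ x; meaningful for Z = X :\ x :|: Y. *)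
Definition operad_comp (X Y Z : {set L}) (x : L)
    (p : monomial_space X) (q : monomial_space Y) : monomial_space Z :=
  operad_proj Z (\sum_t \sum_u (p t * q u) *: mono Z (graft x (val t) (val u))).

(* The identity, when X = Z. *)
Definition operad_cast (X Z : {set L}) (p : monomial_space X) :
    monomial_space Z :=
  \sum_t p t *: mono Z (val t).

End Component.

(* The bar construction F^c(s Pbar) in arity w.+1.  The generators have arity
   2, so this is also its component of weight w.

   A rooted tree with leaves labelled by 'I_w.+1, all of whose vertices have at
   least two inputs, is given by the set T of its vertices, each of them
   identified with the set of leaves above it.  (Pbar vanishes in arities 0
   and 1, so no other trees contribute.)  For w = 0 the only tree is the
   trivial one, without vertices. *)
Section Bar.
Variable w : nat.
Local Notation block := {set 'I_w.+1}.

Definition bar_tree (T : {set block}) :=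
  [&& (0 < w)%N ==> ([set: 'I_w.+1] \in T), [forall A in T, 1 < #|A|]%N &
      [forall A in T, forall B in T,
         [|| A \subset B, B \subset A | [disjoint A & B]]]].

(* The inputs of the vertex A are the vertices and the leaves directly above it. *)
Definition inputs (T : {set block}) (A : block) : {set block} :=
  [set B | [&& (B \in T) || (#|B| == 1)%N, B \proper A &
     [forall C in T, ~~ ((B \proper C) && (C \proper A))]]].

Definition vertex (T : {set block}) := {A : block | A \in T}.

(* A basis of the tensor product of the P(inputs T A), over the vertices A of T. *)
Definition decoration (T : {set block}) :=
  {dffun forall A : vertex T, 'I_(\dim (operad_space (inputs T (val A))))}.
HB.instance Definition _ T := Finite.on (decoration T).

Definition bar_trees (d : nat) :=
  {T : {set block} | bar_tree T && (#|T| == d)}.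

(* A basis of the chains of degree d: each vertex carries a suspended operation,
   and the suspensions are taken in the order of enum T. *)
Definition bar_basis (d : nat) := {T : bar_trees d & decoration (val T)}.

(* The operation at the vertex A (zero if A is not a vertex). *)
Definition bar_label T (b : decoration T) (A : block) :
    monomial_space (inputs T A) :=
  match @idP (A \in T) with
  | ReflectT AT => (vbasis (operad_space (inputs T A)))`_(b (exist _ A AT))
  | ReflectF _ => 0
  end.

(* The operation at the vertex A of T' = T :\ B once the edge from B to its
   parent has been contracted. *)
Definition contract_label T (b : decoration T) (B : block) (T' : {set block})
    (A : block) : monomial_space (inputs T' A) :=
  if B \in inputs T A
  then operad_comp (inputs T' A) B (bar_label b A) (bar_label b B)
  else operad_cast (inputs T' A) (bar_label b A).

(* Contracting the edge from B to its parent A maps sp_A /\ sp_B /\ ... to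
   s(p_A o_B p_B) /\ ...; if n vertices precede B in the enumeration, then
   moving A and B to the front, and the new vertex A back to its place, yields
   the sign (-1)^(n+1). *)
Definition bar_sign (T : {set block}) (B : block) : k :=
  (-1) ^+ #|[set C in T | (enum_rank C < enum_rank B)%N]|.+1.

(* The coefficient of (T', b') in the differential of (T, b). *)
Definition bar_coef T (b : decoration T) T' (b' : decoration T') : k :=
  \sum_(B in T | (B != setT) && (T' == T :\ B))
    bar_sign T B *
    \prod_(A : vertex T')
      coord (vbasis (operad_space (inputs T' (val A)))) (b' A)
            (contract_label b B T' (val A)).

(* The differential from degree d to degree d - 1, acting on row vectors; it
   is zero for d = 0. *)
Definition bar_diff (d : nat) :
    'M[k]_(#|{: bar_basis d}|, #|{: bar_basis d.-1}|) :=
  \matrix_(x, y) bar_coef (tagged (enum_val x : bar_basis d))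
                          (tagged (enum_val y : bar_basis d.-1)).

(* Cycles modulo boundaries, represented by a complement of the boundaries in
   the cycles. *)
Definition bar_homology (d : nat) : 'M[k]_#|{: bar_basis d}| :=
  (kermx (bar_diff d) :\: bar_diff d.+1)%MS.

End Bar.

Definition koszul := forall w d : nat, d != w -> \rank (bar_homology w d) = 0%N.

End QuadraticOperad.

(* Main.v *)
From HB Require Import structures.
Require Import Defs.
From mathcomp Require Import all_boot all_order all_algebra.

(** The black product of PreLie and N is generated by one binary operation
    without symmetry.  Since every composition is a relation of N, its
    relations are the projections of the preLie relators to the three shapes of
    trees with three leaves, namely
      (x y) z = 0   and   x (y z) = x (z y)
    ([black_rel_sum], [op3_false], [op3_true]).  Hence every product of four
    elements vanishes: if the right factor s of x s is itself a product with a
    composite factor, then that factor can be moved to the left in s, where it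
    gives zero ([operad_space_eq0]).

    Write m(x; y, z) for x (y z).  In the bar complex of weight 4, consider the
    trees with three vertices whose root has as inputs the leaf x and two
    vertices, one above the leaves a, b and one above the leaves c, d.
    Contracting an edge of such a tree gives a vertex with four inputs, so all
    its decorations are cycles of degree 3 ([flat_cycle]).  Those whose root is
    m(x; ab, cd) are not boundaries.  Indeed, the binary tree x ((ab) (cd)) has
    boundary
      +- m(x; ab, cd) +- x m(ab; c, d),
    and the other order gives x ((cd) (ab)), with boundary
      +- m(x; cd, ab) +- x m(cd; a, b),
    and no other binary tree involves m(x; ab, cd).  Therefore some linear form
    on the chains of degree 3 takes the values +-1 on the monomials m(x; ab, cd),
    x m(ab; c, d) and x m(cd; a, b), and vanishes on all boundaries: the signs
    depend on the underlying trees only, so the two relations above can be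
    satisfied at once.

    The decorations in the bar complex are the elements of an unspecified basis
    of a complement of the relations.  The linear form is therefore built from
    functionals on the spaces of tree monomials, vanishing on the relations: the
    form on a decorated tree is, up to a sign that depends on the tree only, the
    product over its vertices of functionals among
      [cherry]       the sum of the two coefficients of a binary operation;
      [unary_at h]   the coefficient of h y, for inputs h and y;
      [nested_at h]  the coefficient of h (y z), for inputs h, y and z.
    Contracting an edge turns into the product formula
      nested_at h (p o_B q) = unary_at h p * cherry q
    ([nested_at_graft], [eval_contract_nested]), and the boundary of the binary
    tree above is killed because cherry = unary_at ab + unary_at cd on the
    operations with inputs ab and cd ([eval_cherry_pair],
    [sum_contracted_full]).  On every other tree with four vertices, each
    contraction yields a tree outside the support of the form or a vanishing
    factor ([contracted_value_eq0]). *)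

Set Implicit Arguments.
Unset Strict Implicit.
Unset Printing Implicit Defensive.

Import GRing.Theory.
Local Open Scope ring_scope.

(** * Leaves of trees under plugging and grafting *)
Section TreeLeaves.
Variable I : Type.

Definition is_leaf (L : Type) (t : tree I L) := if t is Leaf _ then true else false.

Lemma perm_leaves_plug (L : eqType) (c : tree I (option L)) (t u : tree I L) :
  perm_eq (leaves t) (leaves u) ->
  perm_eq (leaves (plug c t)) (leaves (plug c u)).
Proof.
move=> tu; elim: c => [[y|]|i l IHl r IHr] //=.
by apply: perm_trans (perm_cat IHl IHr) _.
Qed.

Lemma mem_leaves_graft (L : eqType) (x y : L) (t u : tree I L) :
  (y \in leaves (graft x t u)) =
  ((y \in leaves t) && (y != x)) || ((x \in leaves t) && (y \in leaves u)).
Proof.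
elim: t => [z|i l IHl r IHr] /=; last first.
  rewrite !mem_cat IHl IHr.
  by do 5![case: (_ \in _)]; case: (_ != _).
rewrite /graft /= !inE [z == x]eq_sym; have [<-|] := eqVneq x z.
  by rewrite andbN.
move=> neq_xz; rewrite inE orbF.
by have [->|] := eqVneq y z; rewrite // eq_sym neq_xz.
Qed.

Lemma uniq_leaves_graft (L : eqType) (x : L) (t u : tree I L) :
    uniq (leaves t) -> uniq (leaves u) ->
    (forall y, y \in leaves t -> y \in leaves u -> y = x) ->
  uniq (leaves (graft x t u)).
Proof.
move=> + Uu; elim: t => [z|i l IHl r IHr] /=; first by rewrite /graft /=; case: ifP.
rewrite !cat_uniq => /and3P[Ul /hasPn dis_lr Ur] dis_tu.
rewrite {}IHl ?{}IHr //=; first last.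
- by move=> y y_l; apply: dis_tu; rewrite mem_cat y_l.
- by move=> y y_r; apply: dis_tu; rewrite mem_cat y_r orbT.
rewrite andbT; apply/hasPn=> y /=.
rewrite !mem_leaves_graft => /orP[/andP[yr yx]|/andP[xr yu]].
  rewrite (negPf (dis_lr y yr)) /= negb_and orbC; apply/orP; left.
  by apply: contraNN yx => yu; apply/eqP/dis_tu; rewrite // mem_cat yr orbT.
rewrite (negPf (dis_lr x xr)) /= orbF; apply/negP=> /andP[yl yx].
by case/eqP: yx; apply: dis_tu; rewrite // mem_cat yl.
Qed.

End TreeLeaves.

(** * Linear forms on the components of a quadratic operad *)
Section Evaluation.
Variables (k : fieldType) (P : quadratic_data k) (L : finType).
Local Notation I := (s2_basis (qd_gen P)).
Implicit Types (X Y Z : {set L}) (S : pred (tree I L)).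

Lemma monomialsP X (t : tree I L) :
  (t \in [seq t <- trees I L | [set x in leaves t] == X]) =
  (uniq (leaves t) && ([set x in leaves t] == X)).
Proof. by rewrite mem_filter mem_trees andbC. Qed.

(** Linear forms on tree monomials are only needed with values 0 and 1 on the
    monomials, so they are given by a predicate on trees; the same predicate
    then serves for all sets of inputs at once. *)
Definition eval S X (p : monomial_space P X) : k^o :=
  \sum_t p t * (S (val t))%:R.

Lemma eval_is_linear S X : linear (@eval S X).
Proof.
move=> c p q; rewrite /eval scaler_sumr -big_split /=.
by apply: eq_bigr => t _; rewrite !ffunE mulrDl /GRing.scale /= mulrA.
Qed.
HB.instance Definition _ S X :=
  GRing.isLinear.Build k (monomial_space P X) k^o _ (@eval S X) (@eval_is_linear S X).

Lemma eval_mono S X (t : tree I L) :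
  eval S (mono (P := P) X t) =
  (uniq (leaves t) && ([set x in leaves t] == X) && S t)%:R.
Proof.
rewrite -monomialsP /eval; set s := [seq _ <- _ | _]; have [Xt|nXt] /= := boolP (t \in s).
  rewrite (bigD1 (SeqSub Xt)) //= ffunE eqxx mul1r big1 ?addr0 // => u neq_u.
  by rewrite ffunE -[t]/(ssval (SeqSub Xt)) (inj_eq val_inj) (negPf neq_u) mul0r.
rewrite big1 // => u _; rewrite ffunE; case: eqP => [ut|]; last by rewrite mul0r.
by rewrite -ut /s (valP u) in nXt.
Qed.

Lemma monomial_leaves X (t : monomials P X) :
  uniq (leaves (val t)) /\ [set x in leaves (val t)] = X.
Proof. by have := valP t; rewrite monomialsP => /andP[? /eqP]. Qed.

Lemma mono_sum X (p : monomial_space P X) : p = \sum_t p t *: mono (P := P) X (val t).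
Proof.
apply/ffunP=> u; rewrite sum_ffunE (bigD1 u) //= !ffunE eqxx /GRing.scale /= mulr1.
rewrite big1 ?addr0 // => t neq_t; rewrite !ffunE (inj_eq val_inj) eq_sym.
by rewrite (negPf neq_t) [LHS]mulr0.
Qed.

Definition descends S := forall X (p : monomial_space P X),
  p \in operad_rel P X -> eval S p = 0.

(** The projection to the complement changes an element by a relation only, so
    a form that descends can be computed on any representative. *)
Lemma eval_proj S X (p : monomial_space P X) :
  descends S -> eval S (operad_proj P X p) = eval S p.
Proof.
move=> dS; have RC : (operad_space P X :&: operad_rel P X = 0)%VS.
  by rewrite capvC capv_compl.
have pU : p \in (operad_space P X + operad_rel P X)%VS.
  by rewrite addvC addv_complf memvf.
have /(congr1 (@eval S X)) := daddv_pi_add RC pU.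
rewrite linearD /= => <-.
have -> : eval S (daddv_pi (operad_rel P X) (operad_space P X) p) = 0.
  by apply: dS; exact: memv_pi.
by rewrite addr0.
Qed.

(** If S splits along graftings, then its linear form turns partial
    compositions into products: this reduces the bar differential to tree
    combinatorics.  The equations on X, Y and Z say that no monomial is lost in
    the composite. *)
Lemma eval_comp S S1 S2 (X Y Z : {set L}) x (p : monomial_space P X) q :
    descends S -> x \in X -> Z = X :\ x :|: Y -> [disjoint X :\ x & Y] ->
    (forall t u, [set y in leaves t] = X -> [set y in leaves u] = Y ->
       S (graft x t u) = S1 t && S2 u) ->
  eval S (operad_comp Z x p q : monomial_space P Z) =
  eval S1 p * eval S2 (q : monomial_space P Y).
Proof.
move=> dS Xx ZE dXY S12; rewrite eval_proj // linear_sum.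
rewrite [eval S1 p]/eval [eval S2 q]/eval big_distrlr /=.
apply: eq_bigr => t _; rewrite linear_sum; apply: eq_bigr => u _.
rewrite linearZ /= eval_mono.
have [Ut tX] := monomial_leaves t; have [Uu uY] := monomial_leaves u.
have tXE y : (y \in leaves (val t)) = (y \in X) by rewrite -[in RHS]tX inE.
have uYE y : (y \in leaves (val u)) = (y \in Y) by rewrite -[in RHS]uY inE.
rewrite (S12 _ _ tX uY) uniq_leaves_graft //; last first.
  move=> y; rewrite tXE uYE => yX; apply: contraTeq => yx.
  by rewrite (disjointFr dXY) // !inE yx.
suff -> : [set y in leaves (graft x (val t) (val u))] == Z.
  by rewrite /= -mulnb natrM [LHS]/GRing.scale /= mulrACA.
apply/eqP/setP=> y; rewrite ZE !inE mem_leaves_graft !tXE uYE Xx.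
by rewrite [_ && (y != x)]andbC.
Qed.

Lemma operad_cast_id X (p : monomial_space P X) : operad_cast X p = p.
Proof. by rewrite [RHS]mono_sum. Qed.

Lemma eval_cast S X Z (p : monomial_space P X) :
  X = Z -> eval S (operad_cast Z p : monomial_space P Z) = eval S p.
Proof. by case: _ /; rewrite operad_cast_id. Qed.

End Evaluation.

(** * The relations of the black product *)
Section PreLieNil.
Variable k : fieldType.
Local Notation Op := (black_product (prelie_operad k) (nil_operad k)).
Local Notation gen := (s2_basis (qd_gen Op)).

Definition node (L : Type) (b : bool) (l r : tree gen L) : tree gen L :=
  Node ((b, tt) : gen) l r.

Lemma sum_gen (M : nmodType) (F : gen -> M) : \sum_i F i = F (true, tt) + F (false, tt).
Proof.
transitivity (\sum_(b : bool) \sum_(u : unit) F (b, u)).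
  by rewrite pair_bigA; apply: eq_bigr => -[].
by rewrite big_bool; congr (_ + _); rewrite (big_pred1 tt) // => -[].
Qed.

Lemma swap_gen (b c : bool) (u v : unit) :
  black_swap ((b, u) : s2_basis (reg_gen k) * s2_basis (sgn_gen k)) (c, v) =
    (c == ~~ b)%:R.
Proof. by rewrite /black_swap /= /reg_swap /sgn_swap mulrN1 opprK. Qed.

(** The constant shifts of a are those of the cyclic renamings that bring each
    monomial of the relator to the standard position of its shape. *)
Lemma prelie_relatorE (a a' : 'I_3) (b c : bool) :
  prelie_relator k a (a', b, c) =
    ((a' == a) && ~~ b && ~~ c)%:R - ((a' == a + 1) && b && ~~ c)%:R
    - ((a' == a + 2) && ~~ b && c)%:R + ((a' == a + 1) && b && c)%:R.
Proof. by rewrite !ffunE !xpair_eqE !eqbF_neg !eqb_id. Qed.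

Lemma prelie_rel_sum (r : free3 k (s2_basis (reg_gen k))) a :
  r \in prelie_rel k -> r (a, true, false) + r (a, true, true) = 0.
Proof.
rewrite /prelie_rel => /(@coord_span _ _ _ (in_tuple _)) ->.
rewrite !sum_ffunE -big_split big1 //= => i _; rewrite !ffunE -scalerDr.
have [a' _ ->] : exists2 a', a' \in enum 'I_3 &
    [seq prelie_relator k a | a : 'I_3]`_i = prelie_relator k a'.
  by apply/mapP/mem_nth.
rewrite !prelie_relatorE !andbF !andbT /= ?(andbF, andbT).
by rewrite !(subr0, sub0r, addr0, add0r, oppr0) addrC subrr scaler0.
Qed.

(** Only the coefficients of x (y z) are constrained.  The relator contributes
    to the shape a through - x (y z) + x (z y) for a single renaming of its
    variables, and the two remaining terms live on the shapes (x y) z. *)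
Lemma black_rel_sum (f : free3 k gen) a :
  f \in qd_rel Op -> f (a, (true, tt), (false, tt)) + f (a, (true, tt), (true, tt)) = 0.
Proof.
rewrite /= /black_rel => /(@coord_span _ _ _ (in_tuple _)) ->.
rewrite !sum_ffunE -big_split big1 //= => i _; rewrite !ffunE -scalerDr.
have /allpairsP[[r s] /= [Rr _ ->]] := mem_nth 0 (ltn_ord i).
rewrite !ffunE /= -mulrDl prelie_rel_sum ?mul0r ?scaler0 //.
exact: vbasis_mem.
Qed.

(** By the S_3-symmetry, compositions of shape 0 are enough to generate the
    ideal: other arguments are reached by permuting the inserted trees. *)
Definition op3 (b c : bool) : free3 k gen := e3 k ord0 ((b, tt) : gen) (c, tt).

Lemma op3E b c (w : 'I_3 * gen * gen) :
  op3 b c w = (w.1.1 == ord0)%:R * ((w.1.2.1 == b) && (w.2.1 == c))%:R.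
Proof.
by case: w => [[a [d []]] [e []]]; rewrite ffunE !xpair_eqE /= !andbT -natrM mulnb andbA.
Qed.

(** Tensoring a relator with the basis vector of shape 0 in the relations of N,
    which are all of the free operad, extracts its component of shape 0. *)
Lemma mem_op3 (a : 'I_3) (f : free3 k gen) :
    (forall b c : bool, prelie_relator k a (ord0, b, c) = f (ord0, (b, tt), (c, tt))) ->
    (forall w, w.1.1 != ord0 -> f w = 0) ->
  f \in qd_rel Op.
Proof.
move=> f0 fN0.
have -> : f = Psi (prelie_relator k a) (e3 k ord0 tt tt : free3 k (s2_basis (sgn_gen k))).
  apply/ffunP=> -[[a' [b []]] [c []]]; rewrite [RHS]ffunE /= [e3 _ _ _ _ _]ffunE.
  have [->|a'0] := eqVneq a' ord0; first by rewrite f0 mulr1.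
  by rewrite fN0 // !xpair_eqE (negPf a'0) mulr0.
apply: mem_black_rel; last exact: memvf.
by apply/memv_span/map_f/mem_enum.
Qed.

Lemma op3_false c : op3 false c \in qd_rel Op.
Proof.
case: c; [rewrite -rpredN; apply: (@mem_op3 1)|apply: (@mem_op3 0)] => [b c|w w0|b c|w w0].
- rewrite prelie_relatorE [RHS]ffunE op3E /=.
  by case: b c => [] []; rewrite /= ?(mulr1, mulr0, subr0, sub0r, add0r, addr0, oppr0).
- by rewrite ffunE op3E (negPf w0) mul0r oppr0.
- rewrite prelie_relatorE op3E /=.
  by case: b c => [] []; rewrite /= ?(mulr1, mulr0, subr0, sub0r, add0r, addr0, oppr0).
by rewrite op3E (negPf w0) mul0r.
Qed.

Lemma op3_true : op3 true true - op3 true false \in qd_rel Op.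
Proof.
apply: (@mem_op3 (1 + 1)) => [b c|w w0]; last first.
  by rewrite ffunE [X in _ + X]ffunE !op3E (negPf w0) !mul0r subrr.
rewrite prelie_relatorE [RHS]ffunE [X in _ = _ + X]ffunE !op3E /=.
by case: b c => [] []; rewrite /= ?(mulr1, mulr0, subr0, sub0r, add0r, addr0, oppr0).
Qed.

(** * Linear forms vanishing on the relations *)
Section Functionals.
Variable L : finType.
Local Notation T := (tree gen L).
Implicit Types (A S : pred T) (X : {set L}).

(** The three conditions say that the form of S kills the equivariance
    relations, the products (x y) z and the differences x (y z) - x (z y). *)
Definition compatible S :=
  [/\ forall c b (l r : T), S (plug c (node b l r)) = S (plug c (node (~~ b) r l)),
      forall c b (p q r : T), None \in leaves c ->
        S (plug c (node false (node b p q) r)) = false &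
      forall c (p q r : T), S (plug c (node true (node true p q) r)) =
                            S (plug c (node true (node false p q) r))].

Lemma compatible_descends S : compatible S -> descends (P := Op) S.
Proof.
case=> flipS killS symS X p.
suff /subvP sub : (operad_rel Op X <= lker (linfun (@eval k Op L S X)))%VS.
  by move/sub; rewrite memv_ker lfunE /= => /eqP.
rewrite subv_add; apply/andP; split.
  apply/subv_sumP=> c _; apply/subv_sumP=> -[b []] _.
  apply/subv_sumP=> l _; apply/subv_sumP=> r _.
  rewrite -memvE memv_ker lfunE /= linearB /= sum_gen !swap_gen.
  rewrite linearD !linearZ /= !eval_mono.
  pose u := plug (val c) (node (~~ b) (val r) (val l)).
  have lr : perm_eq (leaves (plug (val c) (node b (val l) (val r)))) (leaves u).
    by apply: perm_leaves_plug; rewrite /= perm_catC.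
  have lrX : ([set x in leaves (plug (val c) (node b (val l) (val r)))] == X) =
             ([set x in leaves u] == X).
    by congr (_ == X); apply/setP=> y; rewrite !inE (perm_mem lr).
  rewrite -/(node b _ _) (perm_uniq lr) lrX flipS -/u.
  rewrite subr_eq0; apply/eqP.
  by move: @u lr lrX; case: b => u _ _; rewrite /= scale0r scale1r ?addr0 ?add0r.
apply/subv_sumP=> c c1; apply/subv_sumP=> t0 _; apply/subv_sumP=> t1 _.
apply/subv_sumP=> t2 _; apply/span_subvP=> _ /mapP[f /vbasis_mem Rf ->].
rewrite memv_ker lfunE /= /plug3 linear_sum /=.
set t := tnth _; apply/eqP.
pose F (a : 'I_3) i j := f (a, i, j) *
  eval S (mono (P := Op) X (plug (val c) (tree3 (P := Op) a i j t))).
transitivity (\sum_a \sum_i \sum_j F a i j).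
  rewrite [RHS]pair_bigA [RHS]pair_bigA; apply: eq_bigr => -[[a i] j] _.
  by rewrite linearZ.
rewrite big1 // => a _; rewrite !sum_gen /F !eval_mono.
rewrite -!/(node _ _ _) !killS // !andbF !mulr0 !addr0.
rewrite -!/(node _ _ _) -symS.
pose v b := plug (val c) (node true (node b (t a) (t (a + 1))) (t (a + 2))).
have lv : leaves (v false) = leaves (v true).
  rewrite /v /plug; elim: (val c) => [[y|] //|i l IHl r IHr] /=.
  by rewrite IHl IHr.
by rewrite -!/(v _) lv -mulrDl addrC black_rel_sum ?mul0r.
Qed.

Lemma compatible_leafy S :
  (forall i l r, S (Node i l r) = false) -> compatible S.
Proof.
by move=> S0; split=> [[[y|]|i c1 c2]|[[y|]|i c1 c2]|[[y|]|i c1 c2]] *; rewrite //= !S0.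
Qed.

(** The label true stands for the opposite product, so both branches describe
    the products of a left factor in A by a right factor in S. *)
Definition pprod A S (t : T) :=
  match t with
  | Leaf _ => false
  | Node (b, _) l r => if b then A r && S l else A l && S r
  end.

(** As A contains leaves only, no product (x y) z lies in [pprod A S]; a
    product x (y z) does if and only if x (z y) does because S ignores the order
    of the factors at the root.  Inside a factor, the conditions on S apply. *)
Lemma compatible_pprod A S :
    (forall i l r, A (Node i l r) = false) -> compatible S ->
    (forall b c l r, S (node b l r) = S (node c l r)) ->
  compatible (pprod A S).
Proof.
move=> A0 [flipS killS symS] topS.
have [flipA killA symA] := compatible_leafy A0.
split=> [[[y|] //|[i []] c1 c2] b l r|[[y|] //|[i []] c1 c2] b p q r|
         [[y|] //|[i []] c1 c2] p q r] /=.
- by case: b.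
- by rewrite -!/(plug _ _) !(flipA _ b l r) !(flipS _ b l r).
- by rewrite A0.
- rewrite -!/(plug _ _) mem_cat => /orP[] cN;
    by rewrite (killA _ b p q r cN) (killS _ b p q r cN) andbF; case: i.
- by rewrite (topS true false).
by rewrite -!/(plug _ _) !symA !symS.
Qed.

Definition cherry := pprod (@is_leaf _ _) (@is_leaf _ _).
Definition unary_at (h : L) := pprod (pred1 (Leaf h)) (@is_leaf _ _).
Definition nested_at (h : L) := pprod (pred1 (Leaf h)) cherry.

Lemma cherry_descends : descends (P := Op) cherry.
Proof.
by apply/compatible_descends/compatible_pprod => //; apply: compatible_leafy.
Qed.

Lemma cherry_top b c (l r : T) : cherry (node b l r) = cherry (node c l r).
Proof. by case: b c => [] []; rewrite /cherry //= andbC. Qed.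

Lemma nested_at_descends h : descends (P := Op) (nested_at h).
Proof.
apply/compatible_descends/compatible_pprod => //; last exact: cherry_top.
by apply: compatible_pprod => //; apply: compatible_leafy.
Qed.

End Functionals.

(** * Vanishing of the operad in arity at least four *)
Section FourInputs.
Variables (L : finType) (X : {set L}).
Local Notation T := (tree gen L).
Local Notation ctx := (tree gen (option L)).

Definition insert3 (c : ctx) (t0 t1 t2 : T) (f : free3 k gen) :=
  plug3 (P := Op) X c f t0 t1 t2.

Lemma insert3_is_linear c t0 t1 t2 : linear (insert3 c t0 t1 t2).
Proof.
move=> a f g; rewrite /insert3 /plug3 scaler_sumr -big_split /=.
by apply: eq_bigr => w _; rewrite !ffunE scalerDl scalerA.
Qed.
HB.instance Definition _ c t0 t1 t2 :=
  GRing.isLinear.Build k (free3 k gen) (monomial_space Op X) _ _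
    (insert3_is_linear c t0 t1 t2).

Lemma insert3_op3 c b b' (t0 t1 t2 : T) :
  insert3 c t0 t1 t2 (op3 b b') =
  mono (P := Op) X (plug c (node b (node b' t0 t1) t2)).
Proof.
rewrite /insert3 /plug3 (bigD1 (ord0, (b, tt) : gen, (b', tt) : gen)) //=.
rewrite op3E /= !eqxx mulr1 scale1r big1 ?addr0 // => -[[a [d []]] [e []]].
by rewrite !xpair_eqE op3E /= !andbT -natrM mulnb andbA => /negPf ->; rewrite scale0r.
Qed.

Lemma insert3_mem c f (t0 t1 t2 : T) :
    f \in qd_rel Op -> uniq (leaves c) -> None \in leaves c ->
    uniq (leaves t0) -> uniq (leaves t1) -> uniq (leaves t2) ->
  insert3 c t0 t1 t2 f \in operad_rel Op X.
Proof.
move=> Rf; rewrite -!mem_trees => Uc cN U0 U1 U2.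
apply: (subvP (addvSr _ _)); rewrite memvE.
apply: (sumv_sup (SeqSub Uc)) => //; apply: (sumv_sup (SeqSub U0)) => //.
apply: (sumv_sup (SeqSub U1)) => //; apply: (sumv_sup (SeqSub U2)) => //=.
rewrite -memvE {1}(coord_vbasis Rf) linear_sum /=.
apply: rpred_sum => i _; rewrite linearZ /= rpredZ // memv_span //.
by apply: map_f; rewrite mem_nth ?size_tuple.
Qed.

Definition vanishes (t : T) := mono (P := Op) X t \in operad_rel Op X.

Lemma memv_subl (vT : vectType k) (U : {vspace vT}) u v :
  u - v \in U -> (u \in U) = (v \in U).
Proof. by move=> Uuv; rewrite -{1}(subrK v u) rpredDl. Qed.

Lemma vanishes_flip c b (l r : T) :
    uniq (leaves c) -> None \in leaves c -> uniq (leaves l) -> uniq (leaves r) ->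
  vanishes (plug c (node b l r)) = vanishes (plug c (node (~~ b) r l)).
Proof.
rewrite -!mem_trees => Uc cN Ul Ur; apply: memv_subl.
apply: (subvP (addvSl _ _)); rewrite memvE.
apply: (sumv_sup (SeqSub Uc)) => //; apply: (sumv_sup ((b, tt) : gen)) => //.
apply: (sumv_sup (SeqSub Ul)) => //; apply: (sumv_sup (SeqSub Ur)) => //=.
rewrite -memvE sum_gen !swap_gen.
suff -> : mono (P := Op) X (plug c (node (~~ b) r l)) =
  (true == ~~ b)%:R *: mono (P := Op) X (plug c (Node ((true, tt) : gen) r l)) +
  (false == ~~ b)%:R *: mono (P := Op) X (plug c (Node ((false, tt) : gen) r l)).
  exact: memv_line.
by case: b; rewrite /= scale1r scale0r ?addr0 ?add0r.
Qed.

Lemma vanishes_left c b (p q r : T) :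
    uniq (leaves c) -> None \in leaves c ->
    uniq (leaves p) -> uniq (leaves q) -> uniq (leaves r) ->
  vanishes (plug c (node false (node b p q) r)).
Proof.
by move=> Uc cN Up Uq Ur; rewrite /vanishes -insert3_op3 insert3_mem ?op3_false.
Qed.

Lemma vanishes_inner c (p q r : T) :
    uniq (leaves c) -> None \in leaves c ->
    uniq (leaves p) -> uniq (leaves q) -> uniq (leaves r) ->
  vanishes (plug c (node true (node true p q) r)) =
  vanishes (plug c (node true (node false p q) r)).
Proof.
move=> Uc cN Up Uq Ur; rewrite /vanishes -!insert3_op3; apply: memv_subl.
by rewrite -linearB insert3_mem // op3_true.
Qed.

(** Up to the order of the factors at the root, t is a product x s.  It is zero
    if x is composite.  If x is a leaf, then s has three leaves or more, so one
    of its factors is composite; since x (p q) = x (q p), this may be taken to be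
    the left factor of s, and then s is zero. *)
Lemma vanishes_four (t : T) :
  uniq (leaves t) -> (3 < size (leaves t))%N -> vanishes t.
Proof.
pose hole := Leaf None : ctx.
have plug_hole u : plug hole u = u by [].
suff nodeT l r : uniq (leaves l ++ leaves r) ->
    (3 < size (leaves l ++ leaves r))%N -> vanishes (node true l r).
  case: t => [//|[b []] l r] /= Ut St; rewrite -/(node b l r).
  case: b; first exact: nodeT.
  have:= Ut; rewrite cat_uniq => /and3P[Ul _ Ur].
  rewrite -[node false l r]plug_hole vanishes_flip // plug_hole nodeT //.
    by rewrite uniq_catC.
  by rewrite size_cat addnC -size_cat.
rewrite size_cat cat_uniq => /and3P[Ul _ Ur].
case: r Ur => [y _|[b []] r1 r2 Ur _]; last first.
  rewrite -[node true l _]plug_hole vanishes_flip // -/(node b r1 r2) vanishes_left //.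
    by move: Ur; rewrite /= cat_uniq => /and3P[].
  by move: Ur; rewrite /= cat_uniq => /and3P[].
case: l Ul => [//|[b []] p q] /=; rewrite size_cat addn1 ltnS => Upq Spq.
have [Up Uq] : uniq (leaves p) /\ uniq (leaves q).
  by move: Upq; rewrite cat_uniq => /and3P[].
have nodeC : vanishes (node true (node true p q) (Leaf y)) =
             vanishes (node true (node false p q) (Leaf y)).
  by apply: (vanishes_inner (c := hole)).
pose c := Node ((true, tt) : gen) (Leaf None) (Leaf (Some y)) : ctx.
have [Uc cN] : uniq (leaves c) /\ None \in leaves c by split; last exact: mem_head.
have plug_c b' u v : node true (node b' u v) (Leaf y) = plug c (node b' u v) by [].
suff nodeF : vanishes (node true (node false p q) (Leaf y)).
  by change (vanishes (node true (node b p q) (Leaf y))); case: b; rewrite ?nodeC.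
case: p Up Spq {Upq} nodeC => [z _|[b' []] p1 p2 Up _ _]; last first.
  move: Up; rewrite /= cat_uniq => /and3P[Up1 _ Up2].
  exact: (@vanishes_left c b' p1 p2 q).
(* If p and q were both leaves, t would have three leaves only. *)
case: q Uq => [w _ Spq|[b' []] q1 q2 Uq _ <-]; first discriminate Spq.
have:= Uq; rewrite /= cat_uniq => /and3P[Uq1 _ Uq2].
rewrite plug_c vanishes_flip //; exact: (@vanishes_left c b' q1 q2).
Qed.

Lemma operad_space_eq0 : (3 < #|X|)%N -> \dim (operad_space Op X) = 0%N.
Proof.
move=> X4; suff relT : operad_rel Op X = fullv by rewrite dimv_compl relT subnn.
apply/eqP; rewrite eqEsubv subvf /=; apply/subvP=> p _; rewrite (@mono_sum k Op L X p).
apply: rpred_sum => t _; rewrite rpredZ //; have [Ut tX] := monomial_leaves t.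
apply: vanishes_four => //; rewrite -(card_uniqP Ut) (leq_trans X4) //.
by rewrite -{1}tX cardsE.
Qed.

End FourInputs.
End PreLieNil.

(** * Contractions in the bar complex *)

(** Dependent version of the distributivity of products over sums: the
    decorations of a tree have a different basis at each vertex. *)
Lemma big_dffun_distr (R : comNzRingType) (I : finType) (T_ : I -> finType)
    (F : forall i, T_ i -> R) :
  \sum_(f : {dffun forall i, T_ i}) \prod_i F i (f i) = \prod_i \sum_(j : T_ i) F i j.
Proof.
rewrite (reindex (@dffun_of_fprod I T_)); last exact/onW_bij/dffun_of_fprod_bij.
transitivity (\sum_(t : fprod T_) \prod_(i in I) [ffun j => F i j] (t i)).
  by apply: eq_bigr => t _; apply: eq_bigr => i _; rewrite !ffunE.
rewrite big_fprod.
have -> : \prod_i \sum_(j : T_ i) F i j =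
    \prod_i \sum_(u in tagged_with T_ i) untag 0 [ffun j => F i j] u.
  apply: eq_bigr => i _; rewrite -(big_tag (fun i j => [ffun j => F i j] j)).
  by apply: eq_bigr => j _; rewrite ffunE.
by rewrite bigA_distr_big_dep.
Qed.

Section Bar.
Variables (k : fieldType) (P : quadratic_data k) (w : nat).
Local Notation block := {set 'I_w.+1}.
Implicit Types (T : {set block}) (A B C : block).

Lemma inputsP T A C :
  reflect [/\ (C \in T) || (#|C| == 1)%N, C \proper A &
              forall D, D \in T -> C \proper D -> ~~ (D \proper A)]
          (C \in inputs T A).
Proof.
rewrite inE; apply: (iffP and3P) => -[CT CA noD]; split=> //.
  by move=> D DT CD; move/forall_inP: noD => /(_ D DT); rewrite CD.
apply/forall_inP=> D DT; rewrite negb_and orbC -implyNb negbK; apply/implyP.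
by move=> /(contraTN (noD D DT)).
Qed.

Lemma inputs_setD1 T A B : B \in T -> B \notin inputs T A ->
  inputs (T :\ B) A = inputs T A.
Proof.
move=> BT BnA; apply/setP=> C; apply/inputsP/inputsP=> -[CT CA noD]; split=> //.
- by move: CT; rewrite inE => /orP[/andP[_ ->]|->] //; rewrite orbT.
- move=> D DT CD; have [DB|DB] := eqVneq D B; last by apply: noD; rewrite ?inE ?DB.
  rewrite {}DB in CD *; apply: contra BnA => BA; apply/inputsP; split=> //.
    by rewrite BT.
  move=> E ET BE; apply: noD (proper_trans CD BE).
  by rewrite in_setD1 ET andbT eq_sym (proper_neq BE).
- rewrite !inE; have [CB|//] := eqVneq C B; case/negP: BnA; apply/inputsP.
  by rewrite -CB.
by move=> D; rewrite inE => /andP[_]; apply: noD.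
Qed.

Lemma bar_treeP T : bar_tree T ->
  [/\ (0 < w)%N ==> (setT \in T), forall A, A \in T -> (1 < #|A|)%N &
      forall A B, A \in T -> B \in T -> [|| A \subset B, B \subset A | [disjoint A & B]]].
Proof.
case/and3P=> -> /forall_inP Tgt1 /forall_inP Tlam; split=> // A B AT BT.
exact: (forall_inP (Tlam A AT)).
Qed.

Lemma inputs_gt0 T A C : bar_tree T -> C \in inputs T A -> (0 < #|C|)%N.
Proof.
by move=> /bar_treeP[_ Tgt1 _] /inputsP[/orP[/Tgt1/ltnW//|/eqP->//] _ _].
Qed.

(** Once B is removed, nothing separates an input of B from A: this is where
    two vertices have to be nested or disjoint. *)
Lemma inputs_contract T A B : bar_tree T -> B \in T -> B \in inputs T A ->
  inputs (T :\ B) A = inputs T A :\ B :|: inputs T B.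
Proof.
move=> barT BT BinA; have [_ Tgt1 Tlam] := bar_treeP barT.
have /inputsP[_ BA noDB] := BinA; apply/setP=> C.
rewrite in_setU in_setD1; apply/inputsP/idP => [[CT CA noD]|].
  have {}CT : (C != B) && ((C \in T) || (#|C| == 1)%N).
    case/orP: CT => [|C1]; first by rewrite in_setD1 => /andP[-> ->].
    by rewrite C1 orbT andbT; apply: contraTneq C1 => ->; rewrite neq_ltn Tgt1 ?orbT.
  case/andP: CT => nCB CT; rewrite nCB /=; have [CB|nsCB] := boolP (C \proper B).
    apply/orP; right; apply/inputsP; split=> // D DT CD; apply/negP=> DB.
    apply: (negP (noD D _ CD)); last exact: proper_trans DB BA.
    by rewrite in_setD1 DT (proper_neq DB).
  apply/orP; left; apply/inputsP; split=> // D DT CD; apply: noD => //.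
  by rewrite in_setD1 DT andbT; apply: contraNneq nsCB => <-.
case/orP=> [/andP[nCB /inputsP[CT CA noD]]|CinB].
  split=> //; first by rewrite in_setD1 nCB.
  by move=> D /setD1P[_]; apply: noD.
have C0 := inputs_gt0 barT CinB; have /inputsP[CT CB noD] := CinB.
split; [by rewrite in_setD1 (proper_neq CB)|exact: proper_trans CB BA|].
move=> D /setD1P[nDB DT] CD; apply/negP=> DA.
case/or3P: (Tlam D B DT BT) => [DB|BD|].
- by case/negP: (noD D DT CD); rewrite properEneq nDB.
- have BD' : B \proper D by rewrite properEneq eq_sym nDB.
  by case/negP: (noDB D DT BD').
case/card_gt0P: C0 => x xC /disjointFr/(_ (subsetP (proper_sub CD) x xC)).
by rewrite (subsetP (proper_sub CB) x xC).
Qed.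

Lemma inputs_disjoint T A B : bar_tree T -> B \in T -> B \in inputs T A ->
  [disjoint inputs T A :\ B & inputs T B].
Proof.
move=> barT BT /inputsP[_ BA _]; rewrite disjoint_subset; apply/subsetP=> C.
rewrite in_setD1 => /andP[_ /inputsP[_ _ noD]]; apply/negP=> /inputsP[_ CB _].
by have /negP := noD B BT CB; apply.
Qed.

(** Each element of A lies in a maximal vertex or leaf strictly inside A, and a
    single one of these cannot cover A. *)
Lemma inputs_gt1 T A : (1 < #|A|)%N -> (1 < #|inputs T A|)%N.
Proof.
move=> A1; pose cand i C := [&& (C \in T) || (#|C| == 1)%N, C \proper A & i \in C].
have cover i : i \in A -> exists2 C, C \in inputs T A & i \in C.
  move=> iA; have cand_i : cand i [set i].
    by rewrite /cand cards1 eqxx orbT set11 properEcard sub1set iA cards1 A1.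
  case: (arg_maxnP (fun C => #|C|) cand_i) => C /and3P[CT CA iC] maxC.
  exists C => //; apply/inputsP; split=> // D DT CD; apply/negP=> DA.
  have := maxC D; rewrite /cand DT DA (subsetP (proper_sub CD) i iC) /= => /(_ isT).
  by rewrite leqNgt proper_card.
have [i iA] : exists i, i \in A by apply/card_gt0P; rewrite ltnW.
have [C CA iC] := cover i iA; have /inputsP[_ /properP[_ [j jA jC]] _] := CA.
have [D DA jD] := cover j jA; have CD : C != D by apply: contraNneq jC => ->.
(* [cards2] gives the cardinal of a pair as a boolean plus one. *)
rewrite -[2%N]/(true.+1) -CD -cards2 subset_leq_card //.
by rewrite subUset !sub1set CA.
Qed.

Lemma bar_label_mem T (b : decoration P T) A :
  bar_label b A \in operad_space P (inputs T A).
Proof.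
rewrite /bar_label; case: {-}_ / idP => [AT|_]; last exact: mem0v.
by apply/vbasis_mem/mem_nth; rewrite size_tuple.
Qed.

Lemma contract_label_mem T (b : decoration P T) B A : B \in T ->
  contract_label b B (T :\ B) A \in operad_space P (inputs (T :\ B) A).
Proof.
move=> BT; rewrite /contract_label; case: ifPn => [_|BnA]; first exact: memv_pi.
have := bar_label_mem b A.
by move: (bar_label b A); rewrite -(inputs_setD1 BT BnA) => p; rewrite operad_cast_id.
Qed.

Lemma eval_contract_cast S T (b : decoration P T) B A : B \in T -> B \notin inputs T A ->
  eval S (contract_label b B (T :\ B) A) = eval S (bar_label b A).
Proof.
move=> BT BnA; rewrite /contract_label (negPf BnA).
exact/eval_cast/esym/inputs_setD1.
Qed.

Lemma eval_contract_comp S S1 S2 T (b : decoration P T) B A :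
    bar_tree T -> B \in T -> B \in inputs T A -> descends S ->
    (forall t u, [set y in leaves t] = inputs T A -> [set y in leaves u] = inputs T B ->
       S (graft B t u) = S1 t && S2 u) ->
  eval S (contract_label b B (T :\ B) A) =
  eval S1 (bar_label b A) * eval S2 (bar_label b B).
Proof.
move=> barT BT BA dS S12; rewrite /contract_label BA.
apply: eval_comp => //; first exact: inputs_contract.
exact: inputs_disjoint.
Qed.

(** The coefficients of the differential are coordinates in the chosen bases.
    Summed against a product of functionals over the vertices, the coordinates
    recombine, and the choice of bases disappears. *)
Lemma sum_bar_coef T (b : decoration P T) T'
    (F : block -> pred (tree (s2_basis (qd_gen P)) block)) :
  \sum_(b' : decoration P T')
    bar_coef b b' *
    \prod_(A : vertex T')
      eval (F (val A)) (vbasis (operad_space P (inputs T' (val A))))`_(b' A) =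
  \sum_(B in T | (B != setT) && (T' == T :\ B))
    bar_sign k T B * \prod_(A in T') eval (F A) (contract_label b B T' A).
Proof.
rewrite /bar_coef; under eq_bigr do rewrite big_distrl.
rewrite exchange_big; apply: eq_bigr => B /and3P[BT _ /eqP T'E] /=.
have vA A : contract_label b B T' A \in operad_space P (inputs T' A).
  by rewrite T'E; apply: contract_label_mem.
under eq_bigr do rewrite -mulrA -big_split /=.
rewrite -big_distrr /= (big_dffun_distr (fun (A : vertex T')
   (j : 'I_(\dim (operad_space P (inputs T' (val A))))) =>
  coord (vbasis (operad_space P (inputs T' (val A)))) j (contract_label b B T' (val A)) *
  eval (F (val A)) (vbasis (operad_space P (inputs T' (val A))))`_j)).
congr (_ * _); rewrite [RHS]big_sub; apply: eq_bigr => A _.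
rewrite [in RHS](coord_vbasis (vA (val A))) linear_sum; apply: eq_bigr => j _.
by rewrite linearZ.
Qed.

End Bar.

(** * Detecting bar homology by a linear form *)
Section Criterion.
Variables (k : fieldType) (P : quadratic_data k) (w : nat).
Local Notation block := {set 'I_w.+1}.

(** Were the cycle z a boundary, phi z would be zero; a single linear form thus
    replaces the computation of the ranks of the differentials. *)
Lemma bar_homology_neq0 d (phi : bar_basis P w d -> k) (z : bar_basis P w d) :
    (forall y : bar_basis P w d.-1, bar_coef (tagged z) (tagged y) = 0) ->
    (forall x : bar_basis P w d.+1,
      \sum_(y : bar_basis P w d) bar_coef (tagged x) (tagged y) * phi y = 0) ->
    phi z != 0 ->
  \rank (bar_homology P w d) <> 0%N.
Proof.
move=> dz phid phiz /eqP; rewrite mxrank_eq0 => /eqP H0.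
pose v : 'rV[k]_#|{: bar_basis P w d}| := delta_mx 0 (enum_rank z).
pose f : 'cV[k]_#|{: bar_basis P w d}| := \col_y phi (enum_val y).
have /submxP[u vE] : (v <= bar_diff P w d.+1)%MS.
  apply: submx_trans (_ : (v <= kermx (bar_diff P w d))%MS) _.
    apply/sub_kermxP; rewrite -rowE; apply/rowP=> y.
    by rewrite !mxE enum_rankK dz.
  rewrite -(addsmx_diff_cap_eq (kermx _) (bar_diff P w d.+1)) addsmx_sub capmxSr.
  by rewrite -/(bar_homology P w d) H0 sub0mx.
have df : bar_diff P w d.+1 *m f = 0.
  apply/colP=> x; rewrite !mxE -[RHS](phid (enum_val x)).
  rewrite (reindex_onto (@enum_rank _) (@enum_val _ _)) /=; last first.
    by move=> i _; rewrite enum_valK.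
  apply: eq_big => [y|y _]; first by rewrite enum_rankK eqxx.
  by rewrite !mxE enum_rankK.
have /colP/(_ 0) : v *m f = 0 by rewrite vE -mulmxA df mulmx0.
rewrite -rowE !mxE enum_rankK; exact/eqP.
Qed.

Lemma bar_tree_setD1 (T : {set block}) B : bar_tree T -> B != setT -> bar_tree (T :\ B).
Proof.
move=> /bar_treeP[Troot Tgt1 Tlam] BT; apply/and3P; split.
- by rewrite in_setD1 eq_sym BT.
- by apply/forall_inP=> A /setD1P[_]; apply: Tgt1.
apply/forall_inP=> A /setD1P[_ AT]; apply/forall_inP=> C /setD1P[_].
exact: Tlam.
Qed.

(** The target trees are the contractions T :\ B, which are again trees with
    one vertex less, so the sum over the chains of degree d is a sum over the
    contracted edges.  The linear form considered is a weight of the tree times a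
    product of functionals over its vertices. *)
Lemma sum_bar_diff d (T : {set block}) (b : decoration P T) (c : {set block} -> k)
    (F : {set block} -> block -> pred (tree (s2_basis (qd_gen P)) block)) :
    bar_tree T -> #|T| = d.+1 ->
  \sum_(y : bar_basis P w d) bar_coef b (tagged y) * (c (val (tag y)) *
    \prod_(A : vertex (val (tag y)))
      eval (F (val (tag y)) (val A))
        (vbasis (operad_space P (inputs (val (tag y)) (val A))))`_(tagged y A)) =
  \sum_(B in T | B != setT)
    c (T :\ B) * (bar_sign k T B *
      \prod_(A in T :\ B) eval (F (T :\ B) A) (contract_label b B (T :\ B) A)).
Proof.
move=> barT cardT.
transitivity (\sum_(T' : bar_trees w d) c (val T') *
   \sum_(b' : decoration P (val T')) bar_coef b b' *
   \prod_(A : vertex (val T')) eval (F (val T') (val A))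
     (vbasis (operad_space P (inputs (val T') (val A))))`_(b' A)).
  under [RHS]eq_bigr do rewrite big_distrr.
  rewrite sig_big_dep /=; apply: eq_bigr => y _.
  by rewrite mulrCA.
under eq_bigr do rewrite sum_bar_coef big_distrr.
rewrite (exchange_big_dep (fun B => (B \in T) && (B != setT))) /=; last first.
  by move=> T' B _ /and3P[-> ->].
apply: eq_bigr => B /andP[BT BnT].
have barTB : bar_tree (T :\ B) && (#|T :\ B| == d).
  by rewrite bar_tree_setD1 //= -eqSS -cardT [#|T|](cardsD1 B) BT.
rewrite (big_pred1 (exist _ (T :\ B) barTB : bar_trees w d)) //= => T'.
by rewrite BT BnT.
Qed.

End Criterion.

(** * The linear forms on grafted trees *)
Section GraftFunctionals.
Variable k : fieldType.
Local Notation Op := (black_product (prelie_operad k) (nil_operad k)).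
Local Notation gen := (s2_basis (qd_gen Op)).
Variable L : finType.
Local Notation T := (tree gen L).
Implicit Types (t u : T) (x h : L).

Lemma leaf_graft x t u : ~~ is_leaf u ->
  is_leaf (graft x t u) = is_leaf t && (x \notin leaves t).
Proof.
move=> u0; case: t => [y|//]; rewrite /graft /= inE eq_sym.
by case: eqP; rewrite // (negPf u0).
Qed.

Lemma pred1_graft x h t u : ~~ is_leaf u -> h != x ->
  (graft x t u == Leaf h) = (t == Leaf h).
Proof.
move=> u0 hx; case: t => [y|//]; rewrite /graft /=; have [->|//] := eqVneq y x.
have -> : (u == Leaf h) = false by apply: contraNF u0 => /eqP->.
by apply/esym/negbTE; apply: contraNneq hx => -[->].
Qed.

(** Grafting a composite tree onto a composite tree yields three leaves or
    more, hence never a product of two leaves. *)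
Lemma pprod_leaf_graft (A : pred T) x t u :
    (forall t, A t -> is_leaf t) -> ~~ is_leaf t -> ~~ is_leaf u -> x \in leaves t ->
  pprod A (@is_leaf _ _) (graft x t u) = false.
Proof.
move=> Aleaf; case: t => [//|[b []] l r] _ u0 /=; rewrite mem_cat => xlr.
rewrite -!/(graft _ _ _) !leaf_graft //; apply/negbTE.
have Agraft t : A (graft x t u) -> x \notin leaves t.
  by move/Aleaf; rewrite leaf_graft // => /andP[].
by case: b; apply/negP=> /andP[/Agraft xN /andP[_ xN']]; move: xlr;
  rewrite (negPf xN) (negPf xN').
Qed.

(** A tree h (y z) decomposes as a grafting of composite trees in one way only,
    by cutting the edge between its two vertices. *)
Lemma nested_at_graft x h t u : h != x -> ~~ is_leaf t -> ~~ is_leaf u -> x \in leaves t ->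
  nested_at h (graft x t u) = unary_at h t && cherry u.
Proof.
move=> hx; case: t => [//|[b []] l r] _ u0 /=; rewrite mem_cat => xlr.
have cherryE s : x \in leaves s -> cherry (graft x s u) = is_leaf s && cherry u.
  case: s => [y|[i []] s1 s2] xs /=.
    by move: xs; rewrite inE /graft /= eq_sym => ->.
  exact: (@pprod_leaf_graft (@is_leaf _ _) x (Node (i, tt) s1 s2) u).
rewrite -!/(graft _ _ _) !pred1_graft //; case: b xlr.
  case: eqP => [->|//]; rewrite inE [x == h]eq_sym (negPf hx) orbF /=.
  exact: cherryE.
case: eqP => [->|//]; rewrite inE [x == h]eq_sym (negPf hx) /=.
exact: cherryE.
Qed.

Lemma leaf_card (X : {set L}) t :
  [set y in leaves t] = X -> (1 < #|X|)%N -> ~~ is_leaf t.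
Proof. by case: t => // y <-; rewrite cardsE (card_uniqP _). Qed.

Lemma eval_unary_at_notin h (X : {set L}) (p : monomial_space Op X) :
  h \notin X -> eval (unary_at h) p = 0.
Proof.
move=> hX; rewrite /eval big1 // => t _; have [_ tX] := monomial_leaves t.
case: (boolP (unary_at h (val t))) => [th|]; rewrite ?mulr0 //.
case/negP: hX; rewrite -tX inE; move: th.
by case: (val t) => [//|[[] []] l r] /andP[/eqP-> _] /=; rewrite ?mem_cat mem_head ?orbT.
Qed.

(** A product of u and v starts with u or with v. *)
Lemma eval_cherry_pair (u v : L) (p : monomial_space Op [set u; v]) : u != v ->
  eval (@cherry k L) p = eval (unary_at u) p + eval (unary_at v) p.
Proof.
move=> uv; rewrite /eval -big_split; apply: eq_bigr => t _ /=; rewrite -mulrDr.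
congr (_ * _); have [Ut tX] := monomial_leaves t; case: t Ut tX => s _ /= Ut tX.
have leafP (t : T) : (0 < size (leaves t))%N
  by elim: t => //= i l IHl r _; rewrite size_cat addn_gt0 IHl.
have : size (leaves s) = 2%N by rewrite -(card_uniqP Ut) -cardsE tX cards2 uv.
case: s Ut tX => [//|[b []] l r] /=; rewrite size_cat.
case: l => [y|? l1 l2]; last first.
  move: (leafP l1) (leafP l2) (leafP r); rewrite /= size_cat.
  case: (size (leaves l1)) => // n1; case: (size (leaves l2)) => // n2.
  by case: (size (leaves r)) => // n3; rewrite !(addSn, addnS).
case: r => [z|? l1 l2] /=; last first.
  move: (leafP l1) (leafP l2); rewrite /= size_cat.
  case: (size (leaves l1)) => // n1; case: (size (leaves l2)) => // n2.
  by rewrite !(addSn, addnS).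
move=> _ tX _.
have headE a : a \in [:: y; z] -> 1 = (a == u)%:R + (a == v)%:R :> k.
  move=> a_t; have : a \in [set u; v] by rewrite -tX inE.
  rewrite in_set2 => /orP[/eqP->|/eqP->].
    by rewrite eqxx (negPf uv) addr0.
  by rewrite eqxx eq_sym (negPf uv) add0r.
have leafE (a c : L) : (Leaf a == Leaf c :> T) = (a == c).
  by apply/eqP/eqP=> [[]|->].
rewrite /unary_at /cherry /= !leafE !andbT.
by case: b; apply: headE; rewrite !inE eqxx ?orbT.
Qed.

End GraftFunctionals.

(** * Sets of five leaves *)
Section FiveLeaves.
Local Notation block := {set 'I_4.+1}.

(** Subsets of the leaves are written as bit vectors, so that the relations
    between the vertices of explicit trees are decided by computation. *)
Definition bits (a0 a1 a2 a3 a4 : bool) : block :=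
  [set i : 'I_4.+1 | nth false [:: a0; a1; a2; a3; a4] i].

Lemma forall_I5 (p : pred 'I_5) :
  [forall i, p i] = [&& p (inord 0), p (inord 1), p (inord 2), p (inord 3) & p (inord 4)].
Proof.
apply/forallP/and5P=> [pT|[p0 p1 p2 p3 p4] i]; first by split.
by rewrite -(inord_val i); case: i => [[|[|[|[|[|i]]]]] lti].
Qed.

Lemma bits_ind (p : block -> Prop) :
  (forall a0 a1 a2 a3 a4, p (bits a0 a1 a2 a3 a4)) -> forall B, p B.
Proof.
move=> pT B; pose a j := inord j \in B.
suff -> : B = bits (a 0) (a 1) (a 2) (a 3) (a 4) by [].
apply/setP=> i; rewrite inE /a -[in LHS](inord_val i).
by case: i => [[|[|[|[|[|i]]]]] lti].
Qed.

Lemma bits_sub a0 a1 a2 a3 a4 b0 b1 b2 b3 b4 :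
  (bits a0 a1 a2 a3 a4 \subset bits b0 b1 b2 b3 b4) =
  [&& a0 ==> b0, a1 ==> b1, a2 ==> b2, a3 ==> b3 & a4 ==> b4].
Proof.
transitivity [forall i, (i \in bits a0 a1 a2 a3 a4) ==> (i \in bits b0 b1 b2 b3 b4)].
  by apply/subsetP/forall_inP.
by rewrite forall_I5 !inE !inordK.
Qed.

Lemma bits_eq a0 a1 a2 a3 a4 b0 b1 b2 b3 b4 :
  (bits a0 a1 a2 a3 a4 == bits b0 b1 b2 b3 b4) =
  [&& a0 == b0, a1 == b1, a2 == b2, a3 == b3 & a4 == b4].
Proof.
rewrite eqEsubset !bits_sub.
by case: a0 a1 a2 a3 a4 b0 b1 b2 b3 b4 => [] [] [] [] [] [] [] [] [] [].
Qed.

Lemma bits_disjoint a0 a1 a2 a3 a4 b0 b1 b2 b3 b4 :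
  [disjoint bits a0 a1 a2 a3 a4 & bits b0 b1 b2 b3 b4] =
  [&& ~~ (a0 && b0), ~~ (a1 && b1), ~~ (a2 && b2), ~~ (a3 && b3) & ~~ (a4 && b4)].
Proof.
rewrite disjoints_subset.
have -> : ~: bits b0 b1 b2 b3 b4 = bits (~~ b0) (~~ b1) (~~ b2) (~~ b3) (~~ b4).
  by apply/setP=> -[[|[|[|[|[|i]]]]] lti]; rewrite !inE.
by rewrite bits_sub !implybE !negb_and.
Qed.

Lemma bits_card a0 a1 a2 a3 a4 : #|bits a0 a1 a2 a3 a4| = (a0 + a1 + a2 + a3 + a4)%N.
Proof.
rewrite -sum1_card big_mkcond /= !big_ord_recl big_ord0 !inE /=.
by case: a0 a1 a2 a3 a4 => [] [] [] [] [].
Qed.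

Lemma setT_bits : [set: 'I_4.+1] = bits true true true true true.
Proof. by apply/setP=> -[[|[|[|[|[|i]]]]] lti]; rewrite !inE. Qed.

Definition bits_rel := (bits_eq, bits_sub, bits_disjoint, bits_card, properE).

Definition block_ab := bits true true false false false.
Definition block_cd := bits false false true true false.
Definition block_abcd := bits true true true true false.
Definition leaf_x := bits false false false false true.

End FiveLeaves.

(** * The trees supporting the cycle and its coboundary *)
Section FiveLeafTrees.
Local Notation block := {set 'I_4.+1}.
Implicit Types (s : seq block) (A B C D : block).

Definition tree_of s : {set block} := [set B in s].
(** The trees underlying x m(ab; c, d), x m(cd; a, b) and m(x; ab, cd), then
    the one underlying both x ((ab) (cd)) and x ((cd) (ab)), of which the three
    others are the contractions. *)
Definition tree_ab := tree_of [:: setT; block_abcd; block_ab].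
Definition tree_cd := tree_of [:: setT; block_abcd; block_cd].
Definition tree_flat := tree_of [:: setT; block_ab; block_cd].
Definition tree_full := tree_of [:: setT; block_abcd; block_ab; block_cd].

Lemma mem_inputs s A C : (C \in inputs (tree_of s) A) =
  [&& (C \in s) || (#|C| == 1)%N, C \proper A &
      all (fun D => (C \proper D) ==> ~~ (D \proper A)) s].
Proof.
apply/inputsP/and3P=> [[CT CA noD]|[CT CA /allP noD]]; split=> //.
- by move: CT; rewrite inE.
- by apply/allP=> D Ds; apply/implyP; apply: noD; rewrite inE.
- by rewrite inE.
by move=> D; rewrite inE => /noD/implyP.
Qed.

Definition bitsE := (setT_bits, bits_rel).

Lemma inputs_full_abcd : inputs tree_full block_abcd = [set block_ab; block_cd].
Proof.
apply/setP; apply: bits_ind => a0 a1 a2 a3 a4; rewrite mem_inputs !inE /= !bitsE.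
by case: a0 a1 a2 a3 a4 => [] [] [] [] [].
Qed.

Lemma inputs_flat_root : inputs tree_flat setT = [set leaf_x; block_ab; block_cd].
Proof.
apply/setP; apply: bits_ind => a0 a1 a2 a3 a4; rewrite mem_inputs !inE /= !bitsE.
by case: a0 a1 a2 a3 a4 => [] [] [] [] [].
Qed.

Lemma inputs_flat_ab :
  inputs tree_flat block_ab =
    [set bits true false false false false; bits false true false false false].
Proof.
apply/setP; apply: bits_ind => a0 a1 a2 a3 a4; rewrite mem_inputs !inE /= !bitsE.
by case: a0 a1 a2 a3 a4 => [] [] [] [] [].
Qed.

Lemma inputs_flat_cd :
  inputs tree_flat block_cd =
    [set bits false false true false false; bits false false false true false].
Proof.
apply/setP; apply: bits_ind => a0 a1 a2 a3 a4; rewrite mem_inputs !inE /= !bitsE.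
by case: a0 a1 a2 a3 a4 => [] [] [] [] [].
Qed.

Lemma inputs_full :
  [/\ block_abcd \in inputs tree_full setT,
      (block_ab \notin inputs tree_full setT) &&
      (block_cd \notin inputs tree_full setT),
      (block_abcd \notin inputs tree_full block_ab) &&
      (block_cd \notin inputs tree_full block_ab) &
      (block_abcd \notin inputs tree_full block_cd) &&
      (block_ab \notin inputs tree_full block_cd)].
Proof. by rewrite !mem_inputs !inE /= !bitsE. Qed.

Lemma tree_full_setD1 : [/\ tree_full :\ block_abcd = tree_flat,
  tree_full :\ block_cd = tree_ab & tree_full :\ block_ab = tree_cd].
Proof.
split; apply/setP; apply: bits_ind => a0 a1 a2 a3 a4; rewrite !inE !bitsE;
  by case: a0 a1 a2 a3 a4 => [] [] [] [] [].
Qed.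

Lemma bar_tree_flat : bar_tree tree_flat && (#|tree_flat| == 3).
Proof.
apply/andP; split; last first.
  by rewrite cardsE (card_uniqP _) //= !inE !bitsE.
apply/and3P; split.
- by rewrite !inE eqxx.
- by apply/forall_inP=> A; rewrite !inE => /or3P[]/eqP->; rewrite ?bitsE.
apply/forall_inP=> A; rewrite inE => AT; apply/forall_inP=> B; rewrite inE.
by move: AT; rewrite !inE => /or3P[]/eqP-> /or3P[]/eqP->; rewrite ?bitsE.
Qed.

(** Let s be the vertices of one of the three trees with three vertices, A its
    ternary vertex and h the distinguished input of A.  A tree that contracts to
    s along the edge below B, and differs from the binary tree obtained by adding
    B0, has h strictly above the new vertex B, which is an input of A.  So h is no
    longer an input of A, and a form [nested_at h] vanishes on the
    contraction. *)
Definition isolates s B0 (h : block) A := forall B,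
  [&& (1 < #|B|)%N, B \notin s,
      all (fun D => [|| B \subset D, D \subset B | [disjoint B & D]]) s & B != B0] ==>
  [&& h \proper B, B \proper A & all (fun D => (B \proper D) ==> ~~ (D \proper A)) s].

Lemma isolates_flat : isolates [:: setT; block_ab; block_cd] block_abcd leaf_x setT.
Proof.
apply: bits_ind => a0 a1 a2 a3 a4; rewrite !inE /= !bitsE.
by case: a0 a1 a2 a3 a4 => [] [] [] [] [].
Qed.

Lemma isolates_ab : isolates [:: setT; block_abcd; block_ab] block_cd block_ab block_abcd.
Proof.
apply: bits_ind => a0 a1 a2 a3 a4; rewrite !inE /= !bitsE.
by case: a0 a1 a2 a3 a4 => [] [] [] [] [].
Qed.

Lemma isolates_cd : isolates [:: setT; block_abcd; block_cd] block_ab block_cd block_abcd.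
Proof.
apply: bits_ind => a0 a1 a2 a3 a4; rewrite !inE /= !bitsE.
by case: a0 a1 a2 a3 a4 => [] [] [] [] [].
Qed.

End FiveLeafTrees.

(** * Values of the vertex functionals on contractions *)
Section Contractions.
Variable k : fieldType.
Local Notation Op := (black_product (prelie_operad k) (nil_operad k)).
Local Notation block := {set 'I_4.+1}.
Variables (T : {set block}) (b : decoration Op T).
Hypothesis barT : bar_tree T.
Implicit Types A B : {set 'I_4.+1}.

Lemma inputs_nonleaf A (t : tree (s2_basis (qd_gen Op)) block) :
  A \in T -> [set y in leaves t] = inputs T A -> ~~ is_leaf t.
Proof.
have [_ Tgt1 _] := bar_treeP barT; move=> /Tgt1 A1 tA.
exact: leaf_card tA (inputs_gt1 _ A1).
Qed.

Lemma eval_contract_nested A B h :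
    A \in T -> B \in T -> B \in inputs T A -> h != B ->
  eval (nested_at h) (contract_label b B (T :\ B) A) =
  eval (unary_at h) (bar_label b A) * eval (@cherry _ _) (bar_label b B).
Proof.
move=> AT BT BA hB; apply: eval_contract_comp => //; first exact: nested_at_descends.
move=> t u tA uB.
apply: nested_at_graft; rewrite ?(inputs_nonleaf AT tA) ?(inputs_nonleaf BT uB) //.
by rewrite -tA inE in BA.
Qed.

Lemma eval_contract_isolated s A B B0 h :
    T :\ B = tree_of s -> isolates s B0 h A -> A \in T -> B \in T -> B != B0 ->
  eval (nested_at h) (contract_label b B (T :\ B) A) = 0.
Proof.
move=> TBE iso AT BT nB; have [_ Tgt1 Tlam] := bar_treeP barT.
have sT D : D \in s -> D \in T.
  by move=> Ds; have /setD1P[] : D \in T :\ B by rewrite TBE inE.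
have /and3P[hB BA /allP noD] : [&& h \proper B, B \proper A &
    all (fun D : block => (B \proper D) ==> ~~ (D \proper A)) s].
  apply: (implyP (iso B)); apply/and4P; split=> //; first exact: Tgt1.
    by have := setD11 B T; rewrite TBE inE => ->.
  by apply/allP=> D /sT DT; apply: Tlam.
have BinA : B \in inputs T A.
  apply/inputsP; split; rewrite ?BT // => D DT BD; apply: (implyP (noD D _)) => //.
  by have : D \in T :\ B; [rewrite in_setD1 DT eq_sym (proper_neq BD)|rewrite TBE inE].
rewrite eval_contract_nested ?(proper_neq hB) // eval_unary_at_notin ?mul0r //.
apply/negP=> /inputsP[_ _ noC]; have := noC B BT hB.
by rewrite BA.
Qed.

End Contractions.

(** * The linear form on chains of degree three *)
Section NonKoszul.
Variable k : fieldType.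
Local Notation Op := (black_product (prelie_operad k) (nil_operad k)).
Local Notation gen := (s2_basis (qd_gen Op)).
Local Notation block := {set 'I_4.+1}.

(** The signs of the three contractions of [tree_full] are compensated, and the
    terms of [tree_ab] and [tree_cd] get the opposite sign so that they cancel
    the term of [tree_flat]. *)
Definition tree_weight (T : {set block}) : k :=
  if T == tree_flat then bar_sign k tree_full block_abcd
  else if T == tree_ab then - bar_sign k tree_full block_cd
  else if T == tree_cd then - bar_sign k tree_full block_ab
  else 0.

(** The ternary vertex carries a form [nested_at h], where h is x at the root
    and the remaining vertex ab or cd otherwise; a binary root carries
    [unary_at x], and every other vertex carries the form [cherry]. *)
Definition vertex_functional (T : {set block}) (A : block) : pred (tree gen block) :=
  if A == setT then (if block_abcd \in T then unary_at leaf_x else nested_at leaf_x)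
  else if A == block_abcd then
    (if block_cd \in T then nested_at block_cd else nested_at block_ab)
  else @cherry k _.

Lemma vertex_functional_flat : [/\ vertex_functional tree_flat setT = nested_at leaf_x,
  vertex_functional tree_flat block_ab = @cherry k _ &
  vertex_functional tree_flat block_cd = @cherry k _].
Proof. by rewrite /vertex_functional !inE !bitsE. Qed.

Lemma vertex_functional_ab : [/\ vertex_functional tree_ab setT = unary_at leaf_x,
  vertex_functional tree_ab block_abcd = nested_at block_ab &
  vertex_functional tree_ab block_ab = @cherry k _].
Proof. by rewrite /vertex_functional !inE !bitsE. Qed.

Lemma vertex_functional_cd : [/\ vertex_functional tree_cd setT = unary_at leaf_x,
  vertex_functional tree_cd block_abcd = nested_at block_cd &
  vertex_functional tree_cd block_cd = @cherry k _].
Proof. by rewrite /vertex_functional !inE !bitsE. Qed.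

Lemma tree_weightE : [/\ tree_weight tree_flat = bar_sign k tree_full block_abcd,
  tree_weight tree_ab = - bar_sign k tree_full block_cd &
  tree_weight tree_cd = - bar_sign k tree_full block_ab].
Proof.
have neqT (U V : {set block}) A : A \in U -> A \notin V -> (U == V) = false.
  by move=> AU; apply: contraNF => /eqP <-.
rewrite /tree_weight !eqxx (neqT tree_ab tree_flat block_abcd)
  ?(neqT tree_cd tree_flat block_abcd) ?(neqT tree_cd tree_ab block_cd) //;
  by rewrite !inE !bitsE.
Qed.

Lemma bar_sign_sqr (T : {set block}) B : bar_sign k T B * bar_sign k T B = 1.
Proof. by rewrite -expr2 sqrr_sign. Qed.

Lemma prod_tree_of (s : seq block) (f : block -> k) :
  uniq s -> \prod_(A in tree_of s) f A = \prod_(A <- s) f A.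
Proof. by move=> Us; rewrite big_uniq //=; apply: eq_bigl => A; rewrite inE. Qed.

Definition contracted_value (T : {set block}) (b : decoration Op T) B : k :=
  tree_weight (T :\ B) * (bar_sign k T B *
    \prod_(A in T :\ B)
      eval (vertex_functional (T :\ B) A) (contract_label b B (T :\ B) A)).

Lemma contracted_value_eq0 (T : {set block}) (b : decoration Op T) B :
  bar_tree T -> T != tree_full -> B \in T -> contracted_value b B = 0.
Proof.
move=> barT nTs BT; have [T0E T1E T2E] := tree_full_setD1.
have zero A : A \in T :\ B ->
    eval (vertex_functional (T :\ B) A) (contract_label b B (T :\ B) A) = 0 ->
    contracted_value b B = 0.
  by move=> AT A0; rewrite /contracted_value (bigD1 A) //= A0 mul0r !mulr0.
have nB C : C \in tree_full -> T :\ B = tree_full :\ C -> B != C.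
  move=> CTs TE; apply: contraNneq nTs => BC; apply/eqP.
  by rewrite -(setD1K BT) TE BC setD1K.
have [TE|nT0] := eqVneq (T :\ B) tree_flat.
  have AT : [set: 'I_4.+1] \in T :\ B by rewrite TE !inE eqxx.
  apply: (zero setT) => //; rewrite {1}TE; have [tr tm _] := vertex_functional_flat.
  rewrite tr; apply: (eval_contract_isolated b barT TE isolates_flat) => //.
    by case/setD1P: AT.
  by apply: nB; rewrite ?T0E // !inE eqxx orbT.
have [TE|nT1] := eqVneq (T :\ B) tree_ab.
  have AT : block_abcd \in T :\ B by rewrite TE !inE eqxx orbT.
  apply: (zero block_abcd) => //; rewrite {1}TE; have [tr tm _] := vertex_functional_ab.
  rewrite tm; apply: (eval_contract_isolated b barT TE isolates_ab) => //.
    by case/setD1P: AT.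
  by apply: nB; rewrite ?T1E // !inE eqxx !orbT.
have [TE|nT2] := eqVneq (T :\ B) tree_cd.
  have AT : block_abcd \in T :\ B by rewrite TE !inE eqxx orbT.
  apply: (zero block_abcd) => //; rewrite {1}TE; have [tr tm _] := vertex_functional_cd.
  rewrite tm; apply: (eval_contract_isolated b barT TE isolates_cd) => //.
    by case/setD1P: AT.
  by apply: nB; rewrite ?T2E // !inE eqxx !orbT.
by rewrite /contracted_value /tree_weight (negPf nT0) (negPf nT1) (negPf nT2) mul0r.
Qed.

(** Contracting the edges below abcd, cd and ab respectively, the product
    formula gives the common factor of the forms at the root, ab and cd, times
    cherry, - unary_at ab and - unary_at cd on the operation at abcd. *)
Lemma sum_contracted_full (b : decoration Op tree_full) :
  bar_tree tree_full ->
  contracted_value b block_abcd + contracted_value b block_ab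
    + contracted_value b block_cd = 0.
Proof.
move=> barT; have [T0E T1E T2E] := tree_full_setD1; have [w0 w1 w2] := tree_weightE.
have [in_root /andP[nab_root ncd_root] /andP[nabcd_ab ncd_ab] /andP[nabcd_cd nab_cd]]
  := inputs_full.
have [rootT abcdT abT cdT] : [/\ [set: 'I_4.+1] \in tree_full,
    block_abcd \in tree_full, block_ab \in tree_full & block_cd \in tree_full].
  by rewrite !inE !eqxx ?orbT.
have [ab_abcd cd_abcd] : block_ab \in inputs tree_full block_abcd /\
    block_cd \in inputs tree_full block_abcd.
  by rewrite inputs_full_abcd !inE !eqxx orbT.
pose r := eval (unary_at leaf_x) (bar_label b setT).
pose p := eval (@cherry k _) (bar_label b block_ab).
pose q := eval (@cherry k _) (bar_label b block_cd).
have val0 : contracted_value b block_abcd =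
    r * eval (@cherry k _) (bar_label b block_abcd) * (p * q).
  rewrite /contracted_value T0E w0 [LHS]mulrA bar_sign_sqr mul1r.
  rewrite prod_tree_of; last by rewrite /= !inE !bitsE.
  rewrite !big_cons big_nil mulr1.
  have [-> -> ->] := vertex_functional_flat; rewrite -T0E.
  congr (_ * (_ * _)).
  - by apply: (eval_contract_nested b barT rootT abcdT in_root); rewrite bitsE.
  - exact: (eval_contract_cast (@cherry k _) b abcdT nabcd_ab).
  - exact: (eval_contract_cast (@cherry k _) b abcdT nabcd_cd).
have val1 : contracted_value b block_cd =
    - (r * (eval (unary_at block_ab) (bar_label b block_abcd) * q * p)).
  rewrite /contracted_value T1E w1 mulNr; congr (- _); rewrite [LHS]mulrA bar_sign_sqr mul1r.
  rewrite prod_tree_of; last by rewrite /= !inE !bitsE.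
  rewrite !big_cons big_nil mulr1.
  have [-> -> ->] := vertex_functional_ab; rewrite -T1E.
  congr (_ * (_ * _)).
  - exact: (eval_contract_cast (unary_at leaf_x) b cdT ncd_root).
  - by apply: (eval_contract_nested b barT abcdT cdT cd_abcd); rewrite bitsE.
  - exact: (eval_contract_cast (@cherry k _) b cdT ncd_ab).
have val2 : contracted_value b block_ab =
    - (r * (eval (unary_at block_cd) (bar_label b block_abcd) * p * q)).
  rewrite /contracted_value T2E w2 mulNr; congr (- _); rewrite [LHS]mulrA bar_sign_sqr mul1r.
  rewrite prod_tree_of; last by rewrite /= !inE !bitsE.
  rewrite !big_cons big_nil mulr1.
  have [-> -> ->] := vertex_functional_cd; rewrite -T2E.
  congr (_ * (_ * _)).
  - exact: (eval_contract_cast (unary_at leaf_x) b abT nab_root).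
  - by apply: (eval_contract_nested b barT abcdT abT ab_abcd); rewrite bitsE.
  - exact: (eval_contract_cast (@cherry k _) b abT nab_cd).
have cherryE : eval (@cherry k _) (bar_label b block_abcd) =
    eval (unary_at block_ab) (bar_label b block_abcd) +
    eval (unary_at block_cd) (bar_label b block_abcd).
  move: (bar_label b block_abcd); rewrite inputs_full_abcd => m; apply: eval_cherry_pair.
  by rewrite bitsE.
have alg (r' u v p' q' : k) :
    r' * (u + v) * (p' * q') - r' * (v * p' * q') - r' * (u * q' * p') = 0.
  by rewrite mulrDr mulrDl -[u * q' * p']mulrA [q' * p']mulrC !mulrA addrK subrr.
by rewrite val0 val1 val2 cherryE; apply: alg.
Qed.

Lemma sum_contracted (T : {set block}) (b : decoration Op T) :
  bar_tree T -> \sum_(B in T | B != setT) contracted_value b B = 0.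
Proof.
move=> barT; have [TE|nT] := eqVneq T tree_full; last first.
  by apply: big1 => B /andP[BT _]; apply: contracted_value_eq0.
case: _ / (esym TE) b barT => b barT; rewrite -[RHS](sum_contracted_full b barT).
transitivity (\sum_(B <- [:: block_abcd; block_ab; block_cd]) contracted_value b B).
  rewrite big_uniq /=; last by rewrite !inE !bitsE.
  apply: eq_bigl; apply: bits_ind => a0 a1 a2 a3 a4; rewrite !inE !bitsE.
  by case: a0 a1 a2 a3 a4 => [] [] [] [] [].
by rewrite !big_cons big_nil addr0 addrA.
Qed.

(** Otherwise the form would vanish on the projection of the monomial t, where
    its value is 1. *)
Lemma eval_basis_neq0 (S : pred (tree gen block)) (X : {set block}) t :
    descends (P := Op) S -> uniq (leaves t) -> [set y in leaves t] = X -> S t ->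
  exists j : 'I_(\dim (operad_space Op X)),
    eval S (vbasis (operad_space Op X))`_j != 0.
Proof.
move=> dS Ut tX St; apply/existsP; apply: contraT; rewrite negb_exists => /forallP S0.
have := eval_proj (mono (P := Op) X t) dS.
have Xp : operad_proj Op X (mono (P := Op) X t) \in operad_space Op X by apply: memv_pi.
rewrite eval_mono Ut tX eqxx St (coord_vbasis Xp) linear_sum big1 => [/esym/eqP|j _].
  by rewrite oner_eq0.
by have := S0 j; rewrite negbK linearZ => /eqP /= ->; rewrite scaler0.
Qed.

Lemma exists_flat_decoration : exists b : decoration Op tree_flat,
  \prod_(A : vertex tree_flat) eval (vertex_functional tree_flat (val A))
      (vbasis (operad_space Op (inputs tree_flat (val A))))`_(b A) != 0.
Proof.
have [tr ta tc] := vertex_functional_flat.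
have ex A : A \in tree_flat ->
    exists j : 'I_(\dim (operad_space Op (inputs tree_flat A))),
    eval (vertex_functional tree_flat A)
      (vbasis (operad_space Op (inputs tree_flat A)))`_j != 0.
  rewrite !inE => /or3P[]/eqP->.
  - rewrite tr; apply: (@eval_basis_neq0 _ _
      (node (k := k) false (Leaf leaf_x)
        (node (k := k) false (Leaf block_ab) (Leaf block_cd)))).
    + exact: nested_at_descends.
    + by rewrite /= !inE !bitsE.
    + by rewrite inputs_flat_root; apply/setP=> C; rewrite !inE orbA.
    + by rewrite /nested_at /= eqxx.
  - rewrite ta inputs_flat_ab; apply: (@eval_basis_neq0 _ _
      (node (k := k) false (Leaf (bits true false false false false))
        (Leaf (bits false true false false false)))).
    + exact: cherry_descends.
    + by rewrite /= !inE !bitsE.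
    + by apply/setP=> C; rewrite !inE.
    + by [].
  rewrite tc inputs_flat_cd; apply: (@eval_basis_neq0 _ _
      (node (k := k) false (Leaf (bits false false true false false))
        (Leaf (bits false false false true false)))).
  + exact: cherry_descends.
  + by rewrite /= !inE !bitsE.
  + by apply/setP=> C; rewrite !inE.
  by [].
have /fin_all_exists[j jP] (A : vertex tree_flat) := ex (val A) (valP A).
exists (finfun j : decoration Op tree_flat).
by apply/prodf_neq0 => A _; rewrite ffunE; apply: jP.
Qed.

(** A contraction leaves a root with four inputs, where there is no nonzero
    operation: the target has no basis element at all. *)
Lemma flat_cycle (b : decoration Op tree_flat) T'
    (b' : decoration Op (T' : {set block})) :
  bar_coef b b' = 0.
Proof.
have /andP[barT _] := bar_tree_flat; have [_ Tgt1 _] := bar_treeP barT.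
rewrite /bar_coef big1 // => B /and3P[BT nBT /eqP TE].
have rootT' : [set: 'I_4.+1] \in T' by rewrite TE !inE eq_sym nBT eqxx.
have BinT : B \in inputs tree_flat setT.
  by move: BT nBT; rewrite inputs_flat_root !inE => /or3P[]/eqP->; rewrite ?eqxx ?orbT.
have := b' (exist _ setT rootT'); rewrite /= operad_space_eq0; first by case.
rewrite TE inputs_contract // cardsU.
rewrite (disjoint_setI0 (inputs_disjoint barT BT BinT)) cards0 subn0.
apply: leq_trans (leq_add (leqnn _) (inputs_gt1 _ (Tgt1 B BT))).
rewrite addnS ltnS addnS ltnS addn0.
have : #|inputs tree_flat setT| = 3%N.
  rewrite inputs_flat_root; have -> : [set leaf_x; block_ab; block_cd] =
    [set C in [:: leaf_x; block_ab; block_cd]].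
    by apply/setP=> C; rewrite !inE orbA.
  by rewrite cardsE (card_uniqP _) //= !inE !bitsE.
by move/eqP; rewrite (cardsD1 B) BinT add1n eqSS => /eqP->.
Qed.

End NonKoszul.

Theorem theorem24 (k : fieldType) (char0 : [pchar k]%R =i pred0) :
  ~ koszul (black_product (prelie_operad k) (nil_operad k)).
Proof.
move/(_ 4%N 3%N isT); have [b b_neq0] := exists_flat_decoration k.
pose z : bar_basis (black_product (prelie_operad k) (nil_operad k)) 4 3 :=
  existT _ (exist _ tree_flat bar_tree_flat) b.
pose phi (y : bar_basis (black_product (prelie_operad k) (nil_operad k)) 4 3) : k :=
  tree_weight k (val (tag y)) * \prod_(A : vertex (val (tag y)))
    eval (vertex_functional (val (tag y)) (val A))
      (vbasis (operad_space _ (inputs (val (tag y)) (val A))))`_(tagged y A).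
apply: (@bar_homology_neq0 _ _ 4 3 phi z).
- by move=> y; apply: flat_cycle.
- move=> [[T TP] c]; have /andP[barT /eqP cardT] := TP.
  apply: etrans (sum_contracted c barT).
  exact: (sum_bar_diff c (tree_weight k) (@vertex_functional k) barT cardT).
have [w0 _ _] := tree_weightE k; rewrite /phi /= w0 mulf_neq0 //.
by rewrite /bar_sign signr_eq0.
Qed.
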